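(* Let $n\ge2$ and let $M^n$ be an $n$-dimensional Riemannian submanifold of a real space form $\widetilde N^{n+p}(c)$ (a Riemannian manifold of constant sectional curvature $c$) endowed with the semi-symmetric non-metric connection $\widetilde\nabla_XY=\mathring{\widetilde\nabla}_XY+\phi(Y)X$ associated with a $1$-form $\phi$. For a unit vector $X\in T_xM^n$, $x\in M^n$, put $$\Phi(X):=(n-1)c-\lambda+s(X,X)-n\,\phi(H)+\widetilde g\bigl(P^\perp,\sigma(X,X)\bigr),$$ $$\mathcal H(H,\sigma)=\frac{n-1}{n}\left(2n\|H\|^2-\|\sigma\|^2-(n-2)\|H\|\sqrt{\frac{n\left(\|\sigma\|^2-n\|H\|^2\right)}{n-1}}\right).$$ Then $$\Phi(X)+\mathcal H(H,\sigma)\ \le\ \operatorname{Ric}(X)\ \le\ \Phi(X)+\frac{n^2}{4}\|H\|^2 .$$ In particular, the difference between the upper and the lower bound equals $\frac{n^2}{4}\|H\|^2-\mathcal H(H,\sigma)$, which depends only on $\|H\|$ and $\|\sigma\|$ (and $n$).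
   Context: Setting and notation. $\mathring{\widetilde\nabla}$ is the Levi-Civita connection of the ambient metric $\widetilde g$. Curvature convention: $R(X,Y)Z=\nabla_X\nabla_YZ-\nabla_Y\nabla_XZ-\nabla_{[X,Y]}Z$, $R(X,Y,Z,W)=g(R(X,Y)Z,W)$ (so constant sectional curvature $c$ means $R(X,Y,Z,W)=c\{g(X,W)g(Y,Z)-g(X,Z)g(Y,W)\}$ for the Levi-Civita curvature). For a $1$-form $\phi$ on $\widetilde N$, the (Agashe–Chafle) semi-symmetric non-metric connection is $\widetilde\nabla_XY=\mathring{\widetilde\nabla}_XY+\phi(Y)X$. The vector field $P$ is defined by $\widetilde g(P,X)=\phi(X)$; along $M^n$ write $P=P^\top+P^\perp$ (tangential and normal parts). The $(0,2)$-tensor $s$ on $\widetilde N$ is $s(X,Y)=(\mathring{\widetilde\nabla}_X\phi)(Y)-\phi(X)\phi(Y)$. $M^n$ carries the induced metric. The induced connection $\nabla$ and second fundamental form $\sigma$ are defined by $\widetilde\nabla_XY=\nabla_XY+\sigma(X,Y)$ (tangential plus normal part) for $X,Y$ tangent to $M$; $\sigma$ coincides with the usual Levi-Civita second fundamental form. $R$ denotes the curvature tensor of the induced connection $\nabla$ on $M$. Given an orthonormal frame $\{e_1,\dots,e_n\}$ of $T_xM$: $\|\sigma\|^2=\sum_{i,j}\|\sigma(e_i,e_j)\|^2$, $H=\frac1n\sum_i\sigma(e_i,e_i)$, $\lambda=\sum_{i=1}^n s(e_i,e_i)$ (trace of $s$ over $T_xM$), and $\phi(H)=\widetilde g(P^\perp,H)$.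 Convention for the Ricci curvature: for a unit $X=e_1$ completed to an orthonormal basis of $T_xM$, $\operatorname{Ric}(X):=\sum_{j=2}^nR(X,e_j,e_j,X)$. *)

(* Defs.v *)
From HB Require Import structures.
From mathcomp Require Import all_boot all_order all_algebra.
From mathcomp Require Import all_classical all_reals all_analysis.
From mathcomp Require Import ring lra.
Set Implicit Arguments.
Unset Strict Implicit.
Unset Printing Implicit Defensive.
Import Order.TTheory GRing.Theory Num.Theory.
Import numFieldNormedType.Exports.
Local Open Scope classical_set_scope.
Local Open Scope ring_scope.

(* Vectors are rows and covectors are columns, so that, as for the library's
   'J F x, the differential of F at x sends u to u *m 'J F x. *)

Section Smooth.
Context {R : realType}.

(* The usual notion for an open set A and a finite-dimensional U. *)
Fixpoint Ck (k : nat) (U V : normedModType R) (A : set U) (f : U -> V) : Prop :=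
  if k is k'.+1 then
    (forall x, A x -> differentiable f x) /\
    (forall v : U, Ck k' A (fun x => 'D_v f x))
  else forall x, A x -> {for x, continuous f}.

Definition smooth (U V : normedModType R) (A : set U) (f : U -> V) : Prop :=
  forall k, Ck k A f.

End Smooth.

Section Algebra.
Context {R : realType} {m : nat}.

Definition bil (A : 'M[R]_m) (u v : 'rV[R]_m) : R := (u *m A *m v^T) 0 0.

Definition pairing (a : 'cV[R]_m) (v : 'rV[R]_m) : R := (v *m a) 0 0.

Definition orthonormal_basis (A : 'M[R]_m) (e : 'I_m -> 'rV[R]_m) : Prop :=
  forall a b, bil A (e a) (e b) = (a == b)%:R.

Definition vnorm (A : 'M[R]_m) (u : 'rV[R]_m) : R := Num.sqrt (bil A u u).

Implicit Types (A : 'M[R]_m) (u v : 'rV[R]_m).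

Lemma bilE A u v : bil A u v = \sum_i \sum_j u 0 i * A i j * v 0 j.
Proof.
rewrite /bil mxE exchange_big; apply: eq_bigr => j _.
by rewrite !mxE big_distrl.
Qed.

Lemma bilC A u v : A^T = A -> bil A u v = bil A v u.
Proof.
move=> sA; rewrite /bil; have <- : (u *m A *m v^T)^T = v *m A *m u^T.
  by rewrite !trmx_mul trmxK sA mulmxA.
by rewrite [RHS]mxE.
Qed.

Lemma bil_delta A u v : bil A u v = \sum_k v 0 k * bil A u (delta_mx 0 k).
Proof.
rewrite {1}/bil mxE; apply: eq_bigr => k _.
by rewrite /bil trmx_delta -colE [in RHS]mxE [_^T k 0]mxE mulrC.
Qed.

End Algebra.

(* The maps [chart_map i] and [chart_inv i] are total, but only meaningful on
   [chart_dom i] and on its image respectively. *)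
Record manifold (R : realType) (n : nat) := Manifold {
  carrier :> topologicalType;
  manifold_hausdorff : hausdorff_space carrier;
  manifold_second_countable : @second_countable carrier;
  chart : Type;
  chart_dom : chart -> set carrier;
  chart_map : chart -> carrier -> 'rV[R]_n;
  chart_inv : chart -> 'rV[R]_n -> carrier;
  chart_dom_open : forall i, open (chart_dom i);
  chart_dom_cover : forall x, exists i, chart_dom i x;
  chart_image_open : forall i, open (chart_map i @` chart_dom i);
  chart_mapK : forall i x, chart_dom i x -> chart_inv i (chart_map i x) = x;
  chart_map_continuous : forall i,
    {within chart_dom i, continuous (chart_map i)};
  chart_inv_continuous : forall i,
    {within chart_map i @` chart_dom i, continuous (chart_inv i)};
  transition_smooth : forall i j,
    smooth (chart_map i @` (chart_dom i `&` chart_dom j))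
           (chart_map j \o chart_inv i)
}.

(* Tensor fields are given by their components in all charts, related by the
   transformation law under the transition map from chart i to chart j. *)

Record metric (R : realType) (n : nat) (N : manifold R n) := Metric {
  metric_comp :> chart N -> 'rV[R]_n -> 'M[R]_n;
  metric_smooth : forall i, smooth (chart_map i @` chart_dom i) (metric_comp i);
  metric_sym : forall i x, chart_dom i x ->
    (metric_comp i (chart_map i x))^T = metric_comp i (chart_map i x);
  metric_posdef : forall i x u, chart_dom i x -> u != 0 ->
    0 < bil (metric_comp i (chart_map i x)) u u;
  metric_transition : forall i j x, chart_dom i x -> chart_dom j x ->
    let J := 'J (chart_map j \o chart_inv i) (chart_map i x) in
    metric_comp i (chart_map i x) = J *m metric_comp j (chart_map j x) *m J^T
}.

Record one_form (R : realType) (n : nat) (N : manifold R n) := OneForm {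
  form_comp :> chart N -> 'rV[R]_n -> 'cV[R]_n;
  form_smooth : forall i, smooth (chart_map i @` chart_dom i) (form_comp i);
  form_transition : forall i j x, chart_dom i x -> chart_dom j x ->
    form_comp i (chart_map i x)
    = 'J (chart_map j \o chart_inv i) (chart_map i x)
      *m form_comp j (chart_map j x)
}.

Definition map_in_charts (R : realType) (n m : nat) (M : manifold R n)
    (N : manifold R m) (f : M -> N) (i : chart M) (j : chart N) :
  'rV[R]_n -> 'rV[R]_m := chart_map j \o f \o chart_inv i.

Definition immersion (R : realType) (n m : nat) (M : manifold R n)
    (N : manifold R m) (f : M -> N) : Prop :=
  [/\ continuous f,
      forall i j, smooth (chart_map i @` (chart_dom i `&` f @^-1` chart_dom j))
                         (map_in_charts f i j)
    & forall i j x, chart_dom i x -> chart_dom j (f x) ->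
        row_free ('J (map_in_charts f i j) (chart_map i x))].

Section Connection.
Context {R : realType} {m : nat}.

Local Notation field := ('rV[R]_m -> 'rV[R]_m).

Definition lie_bracket (X Y : field) : field :=
  fun x => 'D_(X x) Y x - 'D_(Y x) X x.

Definition curvature (nabla : field -> field -> field) (X Y Z : field) : field :=
  fun x => nabla X (nabla Y Z) x - nabla Y (nabla X Z) x
           - nabla (lie_bracket X Y) Z x.

(* Tensors are evaluated at a point on vectors u, v, ... by extending the latter
   to the vector fields [cst u], [cst v], ... of constant components. *)
Definition curvature_at (nabla : field -> field -> field) (x u v w : 'rV[R]_m) :
  'rV[R]_m := curvature nabla (cst u) (cst v) (cst w) x.

Variable G : 'rV[R]_m -> 'M[R]_m.

(* The Koszul formula for fields of constant components; see [koszul],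
   [christoffelC] (vanishing torsion) and [christoffel_metric] (metricity). *)
Definition christoffel (x u v : 'rV[R]_m) : 'rV[R]_m :=
  (\row_k (2^-1 * ('D_u (fun y => bil (G y) v (delta_mx 0 k)) x
                   + 'D_v (fun y => bil (G y) u (delta_mx 0 k)) x
                   - 'D_(delta_mx 0 k) (fun y => bil (G y) u v) x)))
  *m invmx (G x).

Definition levi_civita (X Y : field) : field :=
  fun x => 'D_(X x) Y x + christoffel x (X x) (Y x).

Implicit Types x u v w : 'rV[R]_m.

Lemma derive_bil x u v w : differentiable G x ->
  'D_w (fun y => bil (G y) u v) x = bil ('D_w G x) u v.
Proof.
move=> dG; have dc i j y : derivable (fun y => G y i j : R) x y.
  apply: diff_derivable; apply: (differentiable_comp dG (differentiable_coord _ i j)).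
have dk i j : derivable (fun y => u 0 i * v 0 j * G y i j : R) x w.
  by apply: (derivableM (f := cst _)); [exact: derivable_cst|exact: dc].
have -> : (fun y => bil (G y) u v) =
    \sum_i \sum_j (fun y => u 0 i * v 0 j * G y i j).
  apply/funext => y; rewrite bilE fct_sumE; apply: eq_bigr => i _.
  by rewrite fct_sumE; apply: eq_bigr => j _; ring.
rewrite derive_sum => [|i]; last by apply: derivable_sum => j; exact: dk.
rewrite bilE; apply: eq_bigr => i _.
rewrite derive_sum => [|j]; last exact: dk.
apply: eq_bigr => j _; rewrite (deriveMl (f := fun y => G y i j)); last exact: dc.
have dGx : derivable G x w by exact: diff_derivable.
by rewrite derive_mx// !mxE /=; ring.
Qed.

Lemma christoffelC x u v : (\forall y \near x, (G y)^T = G y) ->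
  christoffel x u v = christoffel x v u.
Proof.
move=> sG; rewrite /christoffel; apply: (congr1 (mulmx^~ _)).
apply/rowP => k; rewrite mxE [RHS]mxE.
rewrite [X in _ * (X - _)]addrC; congr (_ * (_ - _)).
apply: near_eq_derive; near=> y; apply: bilC; near: y; exact: sG.
Unshelve. all: by end_near. Qed.

Lemma koszul x u v w : differentiable G x -> G x \in unitmx ->
  bil (G x) (christoffel x u v) w =
  2^-1 * ('D_u (fun y => bil (G y) v w) x + 'D_v (fun y => bil (G y) u w) x
          - 'D_w (fun y => bil (G y) u v) x).
Proof.
have dist (h a b c d : R) : h * (a + b - c) * d = h * (d * a + d * b - d * c).
  by ring.
move=> dG Gu; rewrite /christoffel {1}/bil -[X in X *m _]mulmxA mulVmx// mulmx1 mxE.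
rewrite !derive_bil//.
have -> : 'D_w G x = \sum_k w 0 k *: 'D_(delta_mx 0 k) G x.
  rewrite {1}(row_sum_delta w) !deriveE// linear_sum/=; apply: eq_bigr => k _.
  by rewrite linearZ deriveE.
rewrite [bil ('D_u G x) v w]bil_delta.
rewrite [bil ('D_v G x) u w]bil_delta.
have -> : bil (\sum_k w 0 k *: 'D_(delta_mx 0 k) G x) u v =
   \sum_k w 0 k * bil ('D_(delta_mx 0 k) G x) u v.
  rewrite /bil mulmx_sumr mulmx_suml summxE; apply: eq_bigr => k _.
  by rewrite -scalemxAr -scalemxAl mxE.
rewrite -big_split -sumrB mulr_sumr; apply: eq_bigr => k _.
rewrite mxE [w^T k 0]mxE (derive_bil _ _ u)// (derive_bil _ _ v)//.
by rewrite derive_bil//= dist.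
Qed.

Lemma christoffel_metric x u v w : differentiable G x -> G x \in unitmx ->
  (\forall y \near x, (G y)^T = G y) ->
  'D_w (fun y => bil (G y) u v) x =
  bil (G x) (christoffel x w u) v + bil (G x) u (christoffel x w v).
Proof.
move=> dG Gu sG; rewrite (bilC u); last exact: nbhs_singleton sG.
have S a b c : 'D_c (fun y => bil (G y) a b) x = 'D_c (fun y => bil (G y) b a) x.
  by apply: near_eq_derive; near=> y; apply: bilC; near: y; exact: sG.
rewrite !koszul// (S v u) (S w v) (S w u); field.
Unshelve. all: by end_near. Qed.

Variable phi : 'rV[R]_m -> 'cV[R]_m.

(* s(u, v) = (nabla_u phi)(v) - phi(u) phi(v), nabla being the Levi-Civita
   connection *)
Definition s_tensor (x u v : 'rV[R]_m) : R :=
  'D_u (fun y => pairing (phi y) v) x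
  - pairing (phi x) (levi_civita (cst u) (cst v) x)
  - pairing (phi x) u * pairing (phi x) v.

Definition dual_field (x : 'rV[R]_m) : 'rV[R]_m := (phi x)^T *m invmx (G x).

End Connection.

Definition constant_curvature (R : realType) (m : nat) (N : manifold R m)
    (g : metric N) (c : R) : Prop :=
  forall (j : chart N) (x : N), chart_dom j x ->
  forall X Y Z W : 'rV[R]_m,
    let gx := bil (g j (chart_map j x)) in
    gx (curvature_at (levi_civita (g j)) (chart_map j x) X Y Z) W
    = c * (gx X W * gx Y Z - gx X Z * gx Y W).

(* F : R^n -> R^m is an immersion near the points of interest, G and phi are a
   metric and a 1-form on the target. *)
Section Submanifold.
Context {R : realType} {n m : nat}.
Variables (G : 'rV[R]_m -> 'M[R]_m) (phi : 'rV[R]_m -> 'cV[R]_m).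
Variable F : 'rV[R]_n -> 'rV[R]_m.

Local Notation field := ('rV[R]_n -> 'rV[R]_n).

Definition push (x u : 'rV[R]_n) : 'rV[R]_m := u *m 'J F x.

Definition induced_metric (x : 'rV[R]_n) : 'M[R]_n :=
  'J F x *m G (F x) *m ('J F x)^T.

(* The pull-back along F of the connection
   nabla_Y Z = levi_civita G Y Z + phi(Z) Y of the target: it differentiates a
   vector field W along F in the direction of a field X on the source. *)
Definition ssnm_along (X : field) (W : 'rV[R]_n -> 'rV[R]_m) (x : 'rV[R]_n) :
  'rV[R]_m :=
  'D_(X x) W x + christoffel G (F x) (push x (X x)) (W x)
  + pairing (phi (F x)) (W x) *: push x (X x).

(* The vector u such that w - push x u is G-orthogonal to the image of push x. *)
Definition tangent_comp (x : 'rV[R]_n) (w : 'rV[R]_m) : 'rV[R]_n :=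
  w *m G (F x) *m ('J F x)^T *m invmx (induced_metric x).

Definition normal_part (x : 'rV[R]_n) (w : 'rV[R]_m) : 'rV[R]_m :=
  w - push x (tangent_comp x w).

Definition ambient_derivative (X Y : field) : 'rV[R]_n -> 'rV[R]_m :=
  ssnm_along X (fun x => push x (Y x)).

Definition induced_connection (X Y : field) : field :=
  fun x => tangent_comp x (ambient_derivative X Y x).

Definition sff (x u v : 'rV[R]_n) : 'rV[R]_m :=
  normal_part x (ambient_derivative (cst u) (cst v) x).

Definition R_induced (x u v w z : 'rV[R]_n) : R :=
  bil (induced_metric x) (curvature_at induced_connection x u v w) z.

(* X is meant to be the first vector of the orthonormal frame e. *)
Definition ricci (x : 'rV[R]_n) (X : 'rV[R]_n) (e : 'I_n -> 'rV[R]_n) : R :=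
  \sum_(j < n | (0 < j)%N) R_induced x X (e j) (e j) X.

Definition mean_curvature (x : 'rV[R]_n) (e : 'I_n -> 'rV[R]_n) : 'rV[R]_m :=
  n%:R^-1 *: \sum_k sff x (e k) (e k).

Definition norm_sff (x : 'rV[R]_n) (e : 'I_n -> 'rV[R]_n) : R :=
  Num.sqrt (\sum_k \sum_l vnorm (G (F x)) (sff x (e k) (e l)) ^+ 2).

Definition trace_s (x : 'rV[R]_n) (e : 'I_n -> 'rV[R]_n) : R :=
  \sum_k s_tensor G phi (F x) (push x (e k)) (push x (e k)).

Definition P_normal (x : 'rV[R]_n) : 'rV[R]_m :=
  normal_part x (dual_field G phi (F x)).

Definition Phi_ricci (c : R) (x : 'rV[R]_n) (e : 'I_n -> 'rV[R]_n) (X : 'rV[R]_n) :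
  R :=
  let g := bil (G (F x)) in
  (n%:R - 1) * c - trace_s x e + s_tensor G phi (F x) (push x X) (push x X)
  - n%:R * g (P_normal x) (mean_curvature x e)
  + g (P_normal x) (sff x X X).

End Submanifold.

Definition calH {R : realType} (n : nat) (normH normsigma : R) : R :=
  (n%:R - 1) / n%:R *
  (2 * n%:R * normH ^+ 2 - normsigma ^+ 2
   - (n%:R - 2) * normH *
     Num.sqrt (n%:R * (normsigma ^+ 2 - n%:R * normH ^+ 2) / (n%:R - 1))).

(* Main.v *)
Require Import Defs.
From mathcomp Require Import all_boot all_order all_algebra.
From mathcomp Require Import all_classical all_reals all_analysis.
From mathcomp Require Import perm ring lra.
Import Order.TTheory GRing.Theory Num.Theory.
Import numFieldNormedType.Exports.
Set Implicit Arguments.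
Unset Strict Implicit.
Unset Printing Implicit Defensive.
Local Open Scope classical_set_scope.
Local Open Scope ring_scope.

(** The bounds are the Gauss equation followed by an algebraic inequality on the
second fundamental form.

Gauss equation. Pulling the Levi-Civita connection of the ambient metric back
along the immersion gives an operator [lc_along] on vector fields along the
submanifold; it is torsion free on tangent fields ([lc_along_pushC]), metric
([lc_along_metric]), and its curvature is the ambient curvature
([lc_along_curvature]). The connection of the theorem adds the term phi(W) X,
which changes the curvature by s(X, Z) Y - s(Y, Z) X ([ssnm_along_curvature]).
Splitting into tangential and normal parts, and using that for a normal field
N the tangential part of its Levi-Civita derivative along X is minus the adjoint
of sigma(X, .) applied to N ([weingarten]), one gets [gauss_equation]. Summed
over an orthonormal frame in a space of constant curvature it reads
Ric(X) = Phi(X) + E, where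
E = sum over j >= 2 of <sigma(X, X), sigma(e_j, e_j)> - |sigma(X, e_j)|^2
([ricciE]). The traces in Phi, H and |sigma| may be computed in any orthonormal
frame ([trace_orthonormal]), in particular in the one starting with X.

Inequality. As the sigma(e_j, e_j) add up to n H,
E <= <sigma(X, X), n H - sigma(X, X)> <= n^2 |H|^2 / 4, the last step being
|sigma(X, X) - n H / 2|^2 >= 0. For the lower bound put b_j = sigma(e_j, e_j) - H
and let T = |sigma|^2 - n |H|^2 be the squared norm of the trace-free part of
sigma. Since the b_j add up to zero, the b_j with j >= 2 contribute at least
|b_1|^2 / (n - 1) to T, while every sigma(X, e_j) occurs twice; hence
|b_1|^2 + sum |sigma(X, e_j)|^2 <= (n - 1) T / n. Now
E = (n - 1) |H|^2 + (n - 2) <H, b_1> - |b_1|^2 - sum |sigma(X, e_j)|^2, and the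
Cauchy-Schwarz inequality for <H, b_1> gives the bound.

The analytic input is the symmetry of second derivatives ([derive_commute]):
it yields the vanishing torsion of the pulled-back connection and removes the
third derivatives of the immersion from its curvature. *)

(* Keeps unification from comparing directional derivatives as limits. *)
#[local] Opaque derive.

(** * Differential calculus of matrix-valued functions *)

Section MatrixCalculus.
Context {R : realType} {V : normedModType R}.

(** Differentiability is needed as a Frechet notion, for the chain rule, but the
rules below are all checked on entries: [M] is the sum of its entries times
constant matrices. *)
Lemma differentiable_mxP m n (M : V -> 'M[R]_(m, n)) x :
  differentiable M x <-> forall i j, differentiable (fun y => M y i j : R) x.
Proof.
split=> [dM i j|dM].
  exact: (differentiable_comp dM (differentiable_coord _ i j)).
have -> : M = \sum_i \sum_j (fun y => (M y i j : R) *: delta_mx i j).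
  apply/funext => y; rewrite fct_sumE [LHS]matrix_sum_delta.
  by apply: eq_bigr => i _; rewrite fct_sumE.
apply: differentiable_sum => i; apply: differentiable_sum => j.
exact: differentiableZl.
Qed.

Lemma derive_entry m n (M : V -> 'M[R]_(m, n)) x v i j : differentiable M x ->
  ('D_v M x) i j = 'D_v (fun y => M y i j : R) x.
Proof. by move=> dM; rewrite derive_mx ?mxE//; exact: diff_derivable. Qed.

Lemma differentiable_bigsum (W : normedModType R) (n : nat) (h : 'I_n -> V -> W) x :
  (forall k, differentiable (h k) x) ->
  differentiable (fun y => \sum_k h k y) x.
Proof.
move=> dh; rewrite (_ : (fun y => _) = \sum_k h k); last first.
  by apply/funext => y; rewrite fct_sumE.
exact: differentiable_sum.
Qed.

Lemma derive_bigsum (W : normedModType R) (n : nat) (h : 'I_n -> V -> W) x v :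
  (forall k, differentiable (h k) x) ->
  'D_v (fun y => \sum_k h k y) x = \sum_k 'D_v (h k) x.
Proof.
move=> dh; rewrite (_ : (fun y => _) = \sum_k h k); last first.
  by apply/funext => y; rewrite fct_sumE.
by apply: derive_sum => k; exact: diff_derivable.
Qed.

Lemma derive_mul (f g : V -> R) x v : differentiable f x -> differentiable g x ->
  'D_v (fun y => f y * g y) x = 'D_v f x * g x + f x * 'D_v g x.
Proof.
move=> df dg; rewrite (deriveM (f := f) (g := g)); try exact: diff_derivable.
by rewrite addrC /GRing.scale /=; congr (_ + _); rewrite mulrC.
Qed.

Lemma differentiable_mulmx m n p (A : V -> 'M[R]_(m, n)) (B : V -> 'M[R]_(n, p)) x :
  differentiable A x -> differentiable B x ->
  differentiable (fun y => A y *m B y) x.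
Proof.
move=> /differentiable_mxP dA /differentiable_mxP dB; apply/differentiable_mxP => i j.
rewrite (_ : (fun y => _) = fun y => \sum_k A y i k * B y k j); last first.
  by apply/funext => y; rewrite mxE.
by apply: differentiable_bigsum => k; exact: differentiableM.
Qed.

Lemma derive_mulmx m n p (A : V -> 'M[R]_(m, n)) (B : V -> 'M[R]_(n, p)) x v :
  differentiable A x -> differentiable B x ->
  'D_v (fun y => A y *m B y) x = 'D_v A x *m B x + A x *m 'D_v B x.
Proof.
move=> dA dB; have dAB := differentiable_mulmx dA dB; apply/matrixP => i j.
rewrite derive_entry// !mxE -big_split.
rewrite (_ : (fun y => _) = fun y => \sum_k A y i k * B y k j); last first.
  by apply/funext => y; rewrite mxE.
move: (dA) (dB) => /differentiable_mxP eA /differentiable_mxP eB.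
rewrite derive_bigsum => [|k]; last exact: differentiableM.
by apply: eq_bigr => k _; rewrite derive_mul// !derive_entry.
Qed.

Lemma differentiable_trmx m n (A : V -> 'M[R]_(m, n)) x :
  differentiable A x -> differentiable (fun y => (A y)^T) x.
Proof.
move=> /differentiable_mxP dA; apply/differentiable_mxP => i j.
by rewrite (_ : (fun y => _) = fun y => A y j i)//; apply/funext => y; rewrite mxE.
Qed.

Lemma derive_trmx m n (A : V -> 'M[R]_(m, n)) x v : differentiable A x ->
  'D_v (fun y => (A y)^T) x = ('D_v A x)^T.
Proof.
move=> dA; apply/matrixP => i j.
rewrite derive_entry; last exact: differentiable_trmx.
rewrite mxE derive_entry//; congr ('D_v _ x).
by apply/funext => y; rewrite mxE.
Qed.

Lemma differentiable_scalemx m n (a : V -> R) (A : V -> 'M[R]_(m, n)) x :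
  differentiable a x -> differentiable A x ->
  differentiable (fun y => a y *: A y) x.
Proof.
move=> da /differentiable_mxP dA; apply/differentiable_mxP => i j.
rewrite (_ : (fun y => _) = fun y => a y * A y i j); last first.
  by apply/funext => y; rewrite mxE.
exact: differentiableM.
Qed.

Lemma derive_scalemx m n (a : V -> R) (A : V -> 'M[R]_(m, n)) x v :
  differentiable a x -> differentiable A x ->
  'D_v (fun y => a y *: A y) x = 'D_v a x *: A x + a x *: 'D_v A x.
Proof.
move=> da dA; have eA := (differentiable_mxP _ _).1 dA; apply/matrixP => i j.
rewrite derive_entry; last exact: differentiable_scalemx.
rewrite !mxE derive_entry// -derive_mul//; congr ('D_v _ x).
by apply/funext => y; rewrite mxE.
Qed.

Lemma differentiable_bigprod n (h : 'I_n -> V -> R) x :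
  (forall k, differentiable (h k) x) ->
  differentiable (fun y => \prod_k h k y) x.
Proof.
move=> dh; elim: (index_enum _) => [|k r IH].
  rewrite (_ : (fun y => _) = cst 1); first exact: differentiable_cst.
  by apply/funext => y; rewrite big_nil.
rewrite (_ : (fun y => _) = fun y => h k y * \prod_(j <- r) h j y); last first.
  by apply/funext => y; rewrite big_cons.
exact: differentiableM.
Qed.

Lemma differentiable_det n (A : V -> 'M[R]_n) x :
  differentiable A x -> differentiable (fun y => \det (A y)) x.
Proof.
move=> /differentiable_mxP dA.
pose h (s : 'S_n) y := (-1) ^+ s * \prod_i A y i (s i) : R.
have dh s : differentiable (h s) x.
  apply: (differentiableM (f := cst _)); first exact: differentiable_cst.
  exact: differentiable_bigprod.
rewrite (_ : (fun y => _) = \sum_s h s); last by apply/funext => y; rewrite fct_sumE.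
elim/big_rec: _ => [|s f _ IH]; first exact: differentiable_cst.
exact: differentiableD.
Qed.

(** Differentiability at a point only depends on the germ: needed because the
inverse of a matrix has a rational expression only where the matrix is
invertible. *)
Lemma near_eq_differentiable (W : normedModType R) (f g : V -> W) x :
  (\forall y \near x, f y = g y) -> differentiable f x -> differentiable g x.
Proof.
move=> fg df; have fgx := nbhs_singleton fg.
have [dfc /eqaddoP dfo] := (diff_locallyP _ _).1 df.
have gE : g \o shift x = cst (g x) + 'd f x +o_ (0 : V) id.
  apply/eqaddoP => _/posnumP[e]; have /dfo : 0 < e%:num by [].
  have fg0 : \forall h \near (0 : V), f (h + x) = g (h + x).
    by move: fg; rewrite (near_shift 0)/=; apply: filterS => h; rewrite subr0.
  apply: filterS2 fg0 => // h fgh.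
  by rewrite /GRing.add/= /GRing.opp/= fgh fgx.
apply/diff_locallyP; rewrite (diff_unique dfc gE); by split.
Qed.

Lemma differentiable_adjugate n (A : V -> 'M[R]_n) x :
  differentiable A x -> differentiable (fun y => \adj (A y)) x.
Proof.
move=> /differentiable_mxP dA; apply/differentiable_mxP => i j.
rewrite (_ : (fun y => _) =
  fun y => (-1) ^+ (j + i) * \det (row' j (col' i (A y)))); last first.
  by apply/funext => y; rewrite mxE.
apply: (differentiableM (f := cst _)); first exact: differentiable_cst.
apply: differentiable_det; apply/differentiable_mxP => k l.
rewrite (_ : (fun y => _) = fun y => A y (lift j k) (lift i l))//.
by apply/funext => y; rewrite !mxE.
Qed.

(** Cramer's formula: the inverse is the adjugate over the determinant. *)
Lemma differentiable_invmx n (A : V -> 'M[R]_n) x : differentiable A x ->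
  (\forall y \near x, A y \in unitmx) -> differentiable (fun y => invmx (A y)) x.
Proof.
move=> dA Au.
apply: (near_eq_differentiable (f := fun y => (\det (A y))^-1 *: \adj (A y))).
  by apply: filterS Au => y Ay; rewrite /invmx Ay.
apply: differentiable_scalemx; last exact: differentiable_adjugate.
apply: differentiableV; first exact: differentiable_det.
by have := nbhs_singleton Au; rewrite unitmxE unitfE.
Qed.

End MatrixCalculus.

Section ChainRule.
Context {R : realType} {U V W : normedModType R}.

Lemma derive_comp (f : U -> V) (g : V -> W) x v :
  differentiable f x -> differentiable g (f x) ->
  'D_v (fun y => g (f y)) x = 'D_('D_v f x) g (f x).
Proof.
move=> df dg; have dgf := differentiable_comp df dg.
by rewrite -[fun y => _]/(g \o f) !deriveE// diff_comp.
Qed.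

Lemma deriveDdir (f : U -> W) x u v : differentiable f x ->
  'D_(u + v) f x = 'D_u f x + 'D_v f x.
Proof. by move=> df; rewrite !deriveE// linearD. Qed.

Lemma deriveZdir (f : U -> W) x a v : differentiable f x ->
  'D_(a *: v) f x = a *: 'D_v f x.
Proof. by move=> df; rewrite !deriveE// linearZ. Qed.

Lemma differentiable_near (f : U -> V) x (P : V -> Prop) : differentiable f x ->
  (\forall z \near f x, P z) -> \forall y \near x, P (f y).
Proof. by move=> /differentiable_continuous fc fP; exact: fc fP. Qed.

End ChainRule.

(** * Symmetry of second derivatives *)

Section Young.
Context {R : realType} {V : normedModType R}.

(** Young's argument. The second difference of [h] along [s *: u] and [s *: v]
is an increment over [0, s] of t |-> h (x + t u + s v) - h (x + t u); by the
mean value theorem it is s times a difference of two values of ['D_u h], which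
the differential of ['D_u h] at [x] approximates up to o(s). *)
Lemma second_difference (h : V -> R) (x u v : V) :
  (\forall y \near x, differentiable h y) -> differentiable ('D_u h) x ->
  forall e, 0 < e -> exists2 r, 0 < r & forall s, 0 < s < r ->
    `|h (x + s *: u + s *: v) - h (x + s *: u) - h (x + s *: v) + h x
      - s ^+ 2 * 'D_v ('D_u h) x| <= e * s ^+ 2 * (2 * `|u| + `|v|).
Proof.
move=> dh du e e0; set L := 'd ('D_u h) x.
have Lo : \forall y \near x, `|'D_u h y - 'D_u h x - L (y - x)| <= e * `|y - x|.
  have [_ /eqaddoP /(_ e e0)] := (diff_locallyP _ _).1 du.
  rewrite (near_shift 0 x)/=; apply: filterS => y /=; rewrite subr0 addrK.
  by rewrite /= /GRing.add/= /GRing.opp/= opprD addrA.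
have [d /= d0 dP] := (nbhs_ballP _ _).1 (filterI dh Lo).
have n0 : 0 < `|u| + `|v| + 1 by rewrite ltr_wpDl// addr_ge0.
exists (d / (`|u| + `|v| + 1)); first by rewrite divr_gt0.
move=> s /andP[s0]; rewrite ltr_pdivlMr// => sd.
have near_x a b : 0 <= a <= s -> 0 <= b <= s -> ball x d (a *: u + (b *: v + x)).
  move=> /andP[a0 las] /andP[b0 lbs]; rewrite -ball_normE /ball_/= addrA.
  rewrite distrC addrK (le_lt_trans (ler_normD _ _))// !normrZ !ger0_norm//.
  apply: le_lt_trans sd.
  have au : a * `|u| <= s * `|u| by rewrite ler_wpM2r.
  have bv : b * `|v| <= s * `|v| by rewrite ler_wpM2r.
  lra.
have line y t : differentiable h (t *: u + y) ->
    is_derive t 1 (fun t => h (t *: u + y)) ('D_u h (t *: u + y)).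
  move=> dht.
  have dl : is_diff t (fun t : R => t *: u) (fun z => z *: u).
    exact: is_diff_scalel.
  have df : is_derive t 1 (fun t : R => t *: u + y) u.
    have dt : differentiable (fun t : R => t *: u) t by [].
    have -> : (fun t : R => t *: u + y) = (fun t : R => t *: u) + cst y by [].
    apply: DeriveDef; first by apply: derivableD; exact: diff_derivable.
    rewrite deriveD; try exact: diff_derivable.
    by rewrite derive_cst addr0 deriveE// diff_val scale1r.
  have dft : differentiable (fun t : R => t *: u + y) t.
    by apply/derivable1_diffP; case: df.
  apply: DeriveDef; first by apply: diff_derivable; exact: differentiable_comp dft dht.
  by rewrite derive_comp// derive_val.
pose psi t := h (t *: u + (s *: v + x)) - h (t *: u + x).
pose dpsi t := 'D_u h (t *: u + (s *: v + x)) - 'D_u h (t *: u + x).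
have s_s : 0 <= s <= s by rewrite lexx ltW.
have o_s : (0 : R) <= 0 <= s by rewrite lexx ltW.
have bP t : 0 <= t <= s -> ball x d (t *: u + (s *: v + x)) /\ ball x d (t *: u + x).
  move=> ts; split; first exact: near_x.
  by have := near_x t 0 ts o_s; rewrite scale0r add0r.
have dpsiP t : 0 <= t <= s -> is_derive t 1 psi (dpsi t).
  by move=> /bP[/dP[? _] /dP[? _]]; apply: is_deriveB; exact: line.
have [t||c cs] := @MVT R psi dpsi 0 s s0.
- by rewrite in_itv /= => /andP[? ?]; apply: dpsiP; rewrite !ltW.
- apply: derivable_within_continuous => t; rewrite in_itv/= => /dpsiP.
  by case.
rewrite subr0 => psiE.
have cs' : 0 <= c <= s by move: cs; rewrite in_itv/= => /andP[? ?]; rewrite !ltW.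
have [/dP[_ b1] /dP[_ b2]] := bP c cs'.
have -> : h (x + s *: u + s *: v) - h (x + s *: u) - h (x + s *: v) + h x =
    psi s - psi 0.
  rewrite /psi scale0r !add0r opprB [x + s *: u]addrC [x + s *: v]addrC.
  rewrite -[s *: u + x + _]addrA [x + s *: v]addrC.
  by ring.
rewrite psiE deriveE// -/L.
have E1 : c *: u + (s *: v + x) - x = c *: u + s *: v by rewrite addrA addrK.
have E2 : c *: u + x - x = c *: u by rewrite addrK.
rewrite E1 in b1; rewrite E2 in b2.
have -> : dpsi c * s - s ^+ 2 * L v =
  s * ('D_u h (c *: u + (s *: v + x)) - 'D_u h x - L (c *: u + s *: v)
  - ('D_u h (c *: u + x) - 'D_u h x - L (c *: u))).
  have -> : L (c *: u + s *: v) = L (c *: u) + s * L v :> R.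
    by rewrite linearD [L (s *: v)]linearZ.
  rewrite /dpsi; move: (L v) (L (c *: u)) => l l'; ring.
rewrite normrM gtr0_norm//.
have -> : e * s ^+ 2 * (2 * `|u| + `|v|) =
    s * (e * (s * `|u| + s * `|v|) + e * (s * `|u|)) by ring.
rewrite ler_pM2l//; apply: le_trans (ler_normB _ _) _.
apply: le_trans (lerD b1 b2) _; have /andP[c0 cles] := cs'.
have cu : `|c *: u| <= s * `|u| by rewrite normrZ ger0_norm// ler_wpM2r.
rewrite lerD// ler_pM2l//; apply: le_trans (ler_normD _ _) _; rewrite lerD//.
by rewrite normrZ gtr0_norm.
Qed.

(** The second difference is symmetric in [u] and [v], so both iterated
derivatives are the limit of the same quotient by s^2. *)
Lemma derive_commute_scalar (h : V -> R) (x u v : V) :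
  (\forall y \near x, differentiable h y) ->
  differentiable ('D_u h) x -> differentiable ('D_v h) x ->
  'D_u ('D_v h) x = 'D_v ('D_u h) x.
Proof.
move=> dh du dv; apply/eqP; rewrite -subr_eq0 -normr_le0; apply/ler_addgt0Pl => e e0.
rewrite addr0.
set C := 2 * `|u| + `|v| + (2 * `|v| + `|u|) + 1.
have C0 : 0 < C by rewrite /C ltr_wpDl// !addr_ge0// mulr_ge0.
have eC0 : 0 < e / C by rewrite divr_gt0.
have [r r0 rP] := second_difference v dh du eC0.
have [q q0 qP] := second_difference u dh dv eC0.
pose s := Num.min r q / 2.
have m0 : 0 < Num.min r q by rewrite lt_min r0.
have s0 : 0 < s by rewrite divr_gt0.
have /andP[sr sq] : (s < r) && (s < q).
  by rewrite -lt_min /s ltr_pdivrMr// mulr_natr mulr2n ltrDl.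
have := rP s; rewrite s0 sr => /(_ isT) H1.
have := qP s; rewrite s0 sq => /(_ isT) H2.
rewrite -(ler_pM2l (exprn_gt0 2 s0)) -{1}(gtr0_norm (exprn_gt0 2 s0)) -normrM.
set A := 'D_u _ _ in H2 *; set B := 'D_v _ _ in H1 *.
set D := (X in X - _ * B) in H1.
have D2 : h (x + s *: v + s *: u) - h (x + s *: v) - h (x + s *: u) + h x = D.
  by rewrite /D [x + s *: v + _]addrAC; ring.
rewrite D2 in H2.
have -> : s ^+ 2 * (A - B) = (D - s ^+ 2 * B) - (D - s ^+ 2 * A) by ring.
apply: le_trans (ler_normB _ _) _; apply: le_trans (lerD H1 H2) _.
have -> : s ^+ 2 * e = e / C * s ^+ 2 * C by field; rewrite gt_eqF.
rewrite -mulrDr ler_pM2l; last by rewrite mulr_gt0 ?exprn_gt0.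
by rewrite /C lerDl.
Qed.

Lemma derive_commute m n (f : V -> 'M[R]_(m, n)) (x u v : V) :
  (\forall y \near x, differentiable f y) ->
  differentiable ('D_u f) x -> differentiable ('D_v f) x ->
  'D_u ('D_v f) x = 'D_v ('D_u f) x.
Proof.
move=> df du dv; apply/matrixP => i j.
have E w w' : differentiable ('D_w' f) x ->
    ('D_w ('D_w' f) x : 'M[R]_(m, n)) i j
    = 'D_w (fun y => ('D_w' f y : 'M[R]_(m, n)) i j : R) x.
  exact: (@derive_entry R V m n ('D_w' f) x w i j).
apply: (etrans (E u v dv)); apply: (etrans _ (esym (E v u du))).
have dE w : \forall y \near x, ('D_w f y) i j = 'D_w (fun y => f y i j) y.
  by apply: filterS df => y dy; rewrite derive_entry.
apply: (etrans (near_eq_derive u (dE v))).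
apply: (etrans _ (esym (near_eq_derive v (dE u)))).
apply: derive_commute_scalar.
- by apply: filterS df => y /differentiable_mxP.
- by apply: near_eq_differentiable (dE u) _; move/differentiable_mxP : du.
- by apply: near_eq_differentiable (dE v) _; move/differentiable_mxP : dv.
Qed.

End Young.

(** * Bilinear forms and pairings *)

Section BilTheory.
Context {R : realType} {m : nat}.
Implicit Types (A : 'M[R]_m) (u v w : 'rV[R]_m).

Lemma bilDl A u v w : bil A (u + v) w = bil A u w + bil A v w.
Proof. by rewrite /bil !mulmxDl mxE. Qed.

Lemma bilDr A u v w : bil A u (v + w) = bil A u v + bil A u w.
Proof. by rewrite /bil linearD mulmxDr mxE. Qed.

Lemma bilZl A a u v : bil A (a *: u) v = a * bil A u v.
Proof. by rewrite /bil -!scalemxAl mxE. Qed.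

Lemma bilZr A a u v : bil A u (a *: v) = a * bil A u v.
Proof. by rewrite /bil linearZ/= -scalemxAr mxE. Qed.

Lemma bilNl A u v : bil A (- u) v = - bil A u v.
Proof. by rewrite -scaleN1r bilZl mulN1r. Qed.

Lemma bilNr A u v : bil A u (- v) = - bil A u v.
Proof. by rewrite -scaleN1r bilZr mulN1r. Qed.

Lemma bilBl A u v w : bil A (u - v) w = bil A u w - bil A v w.
Proof. by rewrite bilDl bilNl. Qed.

Lemma bilBr A u v w : bil A u (v - w) = bil A u v - bil A u w.
Proof. by rewrite bilDr bilNr. Qed.

Lemma bil0l A u : bil A 0 u = 0.
Proof. by rewrite -(scale0r 0) bilZl mul0r. Qed.

Lemma bil0r A u : bil A u 0 = 0.
Proof. by rewrite -(scale0r 0) bilZr mul0r. Qed.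

Lemma bil_suml A (I : finType) (P : pred I) (f : I -> 'rV[R]_m) u :
  bil A (\sum_(i | P i) f i) u = \sum_(i | P i) bil A (f i) u.
Proof. by elim/big_rec2: _ => [|i x y _ <-]; rewrite ?bil0l ?bilDl. Qed.

Lemma bil_sumr A (I : finType) (P : pred I) (f : I -> 'rV[R]_m) u :
  bil A u (\sum_(i | P i) f i) = \sum_(i | P i) bil A u (f i).
Proof. by elim/big_rec2: _ => [|i x y _ <-]; rewrite ?bil0r ?bilDr. Qed.

Lemma bilDm A B u v : bil (A + B) u v = bil A u v + bil B u v.
Proof. by rewrite /bil mulmxDr mulmxDl mxE. Qed.

Lemma bilZm a A u v : bil (a *: A) u v = a * bil A u v.
Proof. by rewrite /bil -scalemxAr -scalemxAl mxE. Qed.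

Lemma pairingD (a : 'cV[R]_m) u v : pairing a (u + v) = pairing a u + pairing a v.
Proof. by rewrite /pairing mulmxDl mxE. Qed.

Lemma pairingZ (a : 'cV[R]_m) k u : pairing a (k *: u) = k * pairing a u.
Proof. by rewrite /pairing -scalemxAl mxE. Qed.

Lemma pairingB (a : 'cV[R]_m) u v : pairing a (u - v) = pairing a u - pairing a v.
Proof. by rewrite -scaleN1r pairingD pairingZ mulN1r. Qed.

End BilTheory.

Section PairingCalculus.
Context {R : realType} {V : normedModType R} {m : nat}.

Lemma differentiable_pairing (a : V -> 'cV[R]_m) (U : V -> 'rV[R]_m) x :
  differentiable a x -> differentiable U x ->
  differentiable (fun y => pairing (a y) (U y)) x.
Proof.
move=> da dU.
exact: ((differentiable_mxP _ _).1 (differentiable_mulmx dU da) 0 0).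
Qed.

Lemma derive_pairing (a : V -> 'cV[R]_m) (U : V -> 'rV[R]_m) x w :
  differentiable a x -> differentiable U x ->
  'D_w (fun y => pairing (a y) (U y)) x =
  pairing ('D_w a x) (U x) + pairing (a x) ('D_w U x).
Proof.
move=> da dU; have dM := differentiable_mulmx dU da.
rewrite /pairing -(derive_entry w 0 0 dM) derive_mulmx// mxE.
by rewrite addrC.
Qed.

Lemma differentiable_bil (A : V -> 'M[R]_m) (U W : V -> 'rV[R]_m) x :
  differentiable A x -> differentiable U x -> differentiable W x ->
  differentiable (fun y => bil (A y) (U y) (W y)) x.
Proof.
move=> dA dU dW; have dM := differentiable_mulmx (differentiable_mulmx dU dA)
  (differentiable_trmx dW).
exact: ((differentiable_mxP _ _).1 dM 0 0).
Qed.

Lemma derive_bil_fields (A : V -> 'M[R]_m) (U W : V -> 'rV[R]_m) x w :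
  differentiable A x -> differentiable U x -> differentiable W x ->
  'D_w (fun y => bil (A y) (U y) (W y)) x =
  bil ('D_w A x) (U x) (W x) + bil (A x) ('D_w U x) (W x)
  + bil (A x) (U x) ('D_w W x).
Proof.
move=> dA dU dW; have dWT := differentiable_trmx dW.
have dUA := differentiable_mulmx dU dA.
rewrite /bil -(derive_entry w 0 0 (differentiable_mulmx dUA dWT)).
rewrite derive_mulmx// derive_trmx// derive_mulmx// mulmxDl !mxE.
by congr (_ + _); rewrite addrC.
Qed.

End PairingCalculus.

(** * Christoffel symbols *)

Section Christoffel.
Context {R : realType} {m : nat}.
Variable G : 'rV[R]_m -> 'M[R]_m.
Local Notation Gam := (christoffel G).

(** The Koszul formula with the derivatives of the metric in the three
directions as independent arguments: bilinearity of the Christoffel symbols is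
then an identity between forms with arbitrary matrices. *)
Let koszul_form (A B C : 'M[R]_m) u v d : R :=
  2^-1 * (bil A v d + bil B u d - bil C u v).

Let koszulDl A A' B C u u' v d :
  koszul_form (A + A') B C (u + u') v d =
  koszul_form A B C u v d + koszul_form A' B C u' v d.
Proof. rewrite /koszul_form bilDm (bilDl B) (bilDl C); ring. Qed.

Let koszulZl a A B C u v d :
  koszul_form (a *: A) B C (a *: u) v d = a * koszul_form A B C u v d.
Proof. rewrite /koszul_form bilZm (bilZl B) (bilZl C); ring. Qed.

Let koszulDr A B B' C u v v' d :
  koszul_form A (B + B') C u (v + v') d =
  koszul_form A B C u v d + koszul_form A B' C u v' d.
Proof. rewrite /koszul_form bilDm (bilDl A) (bilDr C); ring. Qed.

Let koszulZr a A B C u v d :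
  koszul_form A (a *: B) C u (a *: v) d = a * koszul_form A B C u v d.
Proof. rewrite /koszul_form bilZm (bilZl A) (bilZr C); ring. Qed.

Lemma christoffelE z u v : differentiable G z ->
  Gam z u v = (\row_k koszul_form ('D_u G z) ('D_v G z) ('D_(delta_mx 0 k) G z)
    u v (delta_mx 0 k)) *m invmx (G z).
Proof.
move=> dG; rewrite /christoffel; apply: (congr1 (mulmx^~ _)); apply/rowP => k.
rewrite mxE [RHS]mxE; move: (delta_mx 0 k) => d.
by rewrite (derive_bil _ _ u dG) (derive_bil _ _ v dG) (derive_bil _ _ d dG).
Qed.

Lemma christoffelDl z u u' v : differentiable G z ->
  Gam z (u + u') v = Gam z u v + Gam z u' v.
Proof.
move=> dG; rewrite !christoffelE// -mulmxDl; apply: (congr1 (mulmx^~ _)).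
apply/rowP => k; rewrite mxE [RHS]mxE [X in _ = X + _]mxE [X in _ = _ + X]mxE.
by rewrite (deriveDdir u u' dG) koszulDl.
Qed.

Lemma christoffelZl z a u v : differentiable G z ->
  Gam z (a *: u) v = a *: Gam z u v.
Proof.
move=> dG; rewrite !christoffelE// scalemxAl; apply: (congr1 (mulmx^~ _)).
apply/rowP => k; rewrite mxE [RHS]mxE [X in _ = _ * X]mxE.
by rewrite (deriveZdir a u dG) koszulZl.
Qed.

Lemma christoffelDr z u v v' : differentiable G z ->
  Gam z u (v + v') = Gam z u v + Gam z u v'.
Proof.
move=> dG; rewrite !christoffelE// -mulmxDl; apply: (congr1 (mulmx^~ _)).
apply/rowP => k; rewrite mxE [RHS]mxE [X in _ = X + _]mxE [X in _ = _ + X]mxE.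
by rewrite (deriveDdir v v' dG) koszulDr.
Qed.

Lemma christoffelZr z a u v : differentiable G z ->
  Gam z u (a *: v) = a *: Gam z u v.
Proof.
move=> dG; rewrite !christoffelE// scalemxAl; apply: (congr1 (mulmx^~ _)).
apply/rowP => k; rewrite mxE [RHS]mxE [X in _ = _ * X]mxE.
by rewrite (deriveZdir a v dG) koszulZr.
Qed.

(** Reduces differentiating the Christoffel symbols along varying vectors to
differentiating finitely many functions of the point. *)
Lemma christoffel_expand z u v : differentiable G z ->
  Gam z u v = \sum_a \sum_b
    (u 0 a * v 0 b) *: Gam z (delta_mx 0 a) (delta_mx 0 b).
Proof.
move=> dG; have add1 (I : finType) (f : I -> 'rV[R]_m) w :
    Gam z (\sum_i f i) w = \sum_i Gam z (f i) w.
  elim/big_rec2: _ => [|i x y _ <-]; last by rewrite christoffelDl.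
  by have := christoffelZl 0 0 w dG; rewrite !scale0r.
have add2 (I : finType) (f : I -> 'rV[R]_m) w :
    Gam z w (\sum_i f i) = \sum_i Gam z w (f i).
  elim/big_rec2: _ => [|i x y _ <-]; last by rewrite christoffelDr.
  by have := christoffelZr 0 w 0 dG; rewrite !scale0r.
rewrite {1}(row_sum_delta u) {1}(row_sum_delta v) add1; apply: eq_bigr => a _.
rewrite add2; apply: eq_bigr => b _.
by rewrite (christoffelZl _ _ _ dG) (christoffelZr _ _ _ dG) scalerA.
Qed.

Lemma differentiable_christoffel z u v :
  (\forall y \near z, differentiable G y) ->
  (forall w, differentiable ('D_w G) z) ->
  (\forall y \near z, G y \in unitmx) ->
  differentiable (fun y => Gam y u v) z.
Proof.
move=> dG ddG Gu; have dGz := nbhs_singleton dG.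
pose r k y : R := koszul_form ('D_u G y) ('D_v G y) ('D_(delta_mx 0 k) G y)
  u v (delta_mx 0 k).
apply: (near_eq_differentiable (f := fun y => (\row_k r k y) *m invmx (G y))).
  by apply: filterS dG => y dy; rewrite christoffelE.
apply: differentiable_mulmx; last exact: differentiable_invmx.
apply/differentiable_mxP => i k.
rewrite (_ : (fun y => _) = r k); last by apply/funext => y; rewrite mxE.
apply: (differentiableM (f := cst _)); first exact: differentiable_cst.
have db w s t : differentiable (fun y => bil ('D_w G y) s t) z.
  by apply: differentiable_bil => //; exact: differentiable_cst.
apply: differentiableB (db _ _ _); exact: differentiableD.
Qed.

End Christoffel.

Section ChristoffelAlong.
Context {R : realType} {m : nat}.

(** The part of smoothness, symmetry and nondegeneracy of the metric that the
curvature at a point involves. *)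
Definition regular_metric_at (G : 'rV[R]_m -> 'M[R]_m) (z : 'rV[R]_m) : Prop :=
  [/\ differentiable G z, forall u, differentiable ('D_u G) z,
      (G z)^T = G z & G z \in unitmx].

Variable G : 'rV[R]_m -> 'M[R]_m.
Local Notation Gam := (christoffel G).

Context {V : normedModType R}.
Variables (z : V -> 'rV[R]_m) (U W : V -> 'rV[R]_m) (x : V).
Hypotheses (dz : differentiable z x) (dU : differentiable U x)
  (dW : differentiable W x).
Hypothesis regG : \forall y \near z x, regular_metric_at G y.

Let dGam a b : differentiable (fun y => Gam y (delta_mx 0 a) (delta_mx 0 b)) (z x).
Proof.
apply: differentiable_christoffel; first by apply: filterS regG => y [].
  by have [] := nbhs_singleton regG.
by apply: filterS regG => y [].
Qed.

Let dUW a b : differentiable (fun y => U y 0 a * W y 0 b) x.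
Proof. by apply: differentiableM; apply: (differentiable_mxP _ _).1. Qed.

Let dGz a b : differentiable (fun y => Gam (z y) (delta_mx 0 a) (delta_mx 0 b)) x.
Proof. exact: (differentiable_comp dz (dGam a b)). Qed.

Let Gz_expand : \forall y \near x, \sum_a \sum_b (U y 0 a * W y 0 b) *:
  Gam (z y) (delta_mx 0 a) (delta_mx 0 b) = Gam (z y) (U y) (W y).
Proof.
apply: filterS (differentiable_near dz regG) => y [dG _ _ _].
by rewrite [RHS]christoffel_expand.
Qed.

Lemma differentiable_christoffel_along :
  differentiable (fun y => Gam (z y) (U y) (W y)) x.
Proof.
apply: near_eq_differentiable Gz_expand _.
apply: differentiable_bigsum => a; apply: differentiable_bigsum => b.
exact: differentiable_scalemx.
Qed.

(** Leibniz rule for the Christoffel symbols, as a trilinear expression in the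
metric and the two vector fields. *)
Lemma derive_christoffel_along w :
  'D_w (fun y => Gam (z y) (U y) (W y)) x =
  'D_('D_w z x) (fun y => Gam y (U x) (W x)) (z x)
  + Gam (z x) ('D_w U x) (W x) + Gam (z x) (U x) ('D_w W x).
Proof.
have dG : differentiable G (z x) by have [] := nbhs_singleton regG.
rewrite -(near_eq_derive _ Gz_expand).
have E : \forall y \near z x, \sum_a \sum_b (U x 0 a * W x 0 b) *:
    Gam y (delta_mx 0 a) (delta_mx 0 b) = Gam y (U x) (W x).
  by apply: filterS regG => y [dGy _ _ _]; rewrite [RHS]christoffel_expand.
rewrite -(near_eq_derive _ E) (christoffel_expand ('D_w U x))//.
rewrite (christoffel_expand (U x))//.
rewrite derive_bigsum; last first.
  by move=> a; apply: differentiable_bigsum => b; exact: differentiable_scalemx.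
have dC a b : differentiable (fun y => (U x 0 a * W x 0 b) *:
    Gam y (delta_mx 0 a) (delta_mx 0 b)) (z x).
  exact: (differentiable_scalemx (differentiable_cst _ _) (dGam a b)).
rewrite derive_bigsum; last by move=> a; exact: differentiable_bigsum.
rewrite -!big_split; apply: eq_bigr => a _ /=.
rewrite derive_bigsum; last by move=> b; exact: differentiable_scalemx.
rewrite derive_bigsum; last by move=> b; exact: dC.
rewrite -!big_split; apply: eq_bigr => b _ /=.
rewrite (derive_scalemx _ (dUW a b) (dGz a b)).
rewrite (derive_scalemx _ (differentiable_cst _ _) (dGam a b)).
rewrite derive_cst scale0r add0r (derive_comp _ dz (dGam a b)).
rewrite (derive_mul _ ((differentiable_mxP _ _).1 dU 0 a)
  ((differentiable_mxP _ _).1 dW 0 b)).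
rewrite -(derive_entry w 0 a dU) -(derive_entry w 0 b dW).
by rewrite [LHS]addrC scalerDl [LHS]addrA.
Qed.

End ChristoffelAlong.

(** * The Levi-Civita connection pulled back along a map *)

Section Pullback.
Context {R : realType} {n m : nat}.
Variables (G : 'rV[R]_m -> 'M[R]_m) (F : 'rV[R]_n -> 'rV[R]_m).
Local Notation Gam := (christoffel G).
Implicit Types (x X Y Z u v : 'rV[R]_n) (V W : 'rV[R]_n -> 'rV[R]_m).

(** Three derivatives are what the curvature of the induced connection
involves. *)
Definition regular_map_at x : Prop :=
  [/\ differentiable F x, forall u, differentiable ('D_u F) x
    & forall u v, differentiable ('D_u ('D_v F)) x].

Lemma pushE x u : differentiable F x -> push F x u = 'D_u F x.
Proof. by move=> dF; rewrite deriveEjacobian. Qed.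

Lemma pushD x u v : push F x (u + v) = push F x u + push F x v.
Proof. exact: mulmxDl. Qed.

Lemma pushZ x a u : push F x (a *: u) = a *: push F x u.
Proof. by rewrite /push scalemxAl. Qed.

(** Covariant derivative, in the constant direction [X] of the source, of a
vector field [W] along [F], for the pull-back of the Levi-Civita connection. *)
Definition lc_along X W x : 'rV[R]_m := 'D_X W x + Gam (F x) (push F x X) (W x).

Lemma differentiable_push x u : (\forall y \near x, regular_map_at y) ->
  differentiable (fun y => push F y u) x.
Proof.
move=> rF; have [_ dd _] := nbhs_singleton rF.
apply: near_eq_differentiable (dd u).
by apply: filterS rF => y [dF _ _]; rewrite pushE.
Qed.

Lemma derive_push x u v : (\forall y \near x, regular_map_at y) ->
  'D_u (fun y => push F y v) x = 'D_u ('D_v F) x.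
Proof.
move=> rF; apply: near_eq_derive.
by apply: filterS rF => y [dF _ _]; rewrite pushE.
Qed.

Lemma derive_pushC x u v : (\forall y \near x, regular_map_at y) ->
  'D_u (fun y => push F y v) x = 'D_v (fun y => push F y u) x.
Proof.
move=> rF; apply: (etrans (derive_push u v rF)).
apply: (etrans _ (esym (derive_push v u rF))).
have [dF ddF _] := nbhs_singleton rF.
by apply: derive_commute => //; apply: filterS rF => y [].
Qed.

Section AtPoint.
Variable x : 'rV[R]_n.
Hypothesis regF : \forall y \near x, regular_map_at y.
Hypothesis regG : \forall z \near F x, regular_metric_at G z.

Let dF : differentiable F x. Proof. by have [] := nbhs_singleton regF. Qed.
Let dG : differentiable G (F x). Proof. by have [] := nbhs_singleton regG. Qed.
Let symG : \forall z \near F x, (G z)^T = G z.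
Proof. by apply: filterS regG => z []. Qed.
Let unitG : G (F x) \in unitmx. Proof. by have [] := nbhs_singleton regG. Qed.

Lemma differentiable_metric_along : differentiable (fun y => G (F y)) x.
Proof. exact: (differentiable_comp dF dG). Qed.

(** The pull-back of a metric connection is metric. *)
Lemma lc_along_metric X V W : differentiable V x -> differentiable W x ->
  'D_X (fun y => bil (G (F y)) (V y) (W y)) x =
  bil (G (F x)) (lc_along X V x) (W x) + bil (G (F x)) (V x) (lc_along X W x).
Proof.
move=> dV dW; rewrite derive_bil_fields//; last exact: differentiable_metric_along.
rewrite (derive_comp _ dF dG) -derive_bil// christoffel_metric// -pushE//.
by rewrite /lc_along bilDl bilDr; ring.
Qed.

(** Vanishing torsion: second derivatives of [F] commute and the Christoffel
symbols are symmetric. *)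
Lemma lc_along_pushC X Y :
  lc_along X (fun y => push F y Y) x = lc_along Y (fun y => push F y X) x.
Proof.
by apply: (congr2 +%R (derive_pushC X Y regF)); exact: christoffelC.
Qed.

End AtPoint.
End Pullback.

Section LeviCivitaCurvature.
Context {R : realType} {n m : nat}.
Variables (G : 'rV[R]_m -> 'M[R]_m) (F : 'rV[R]_n -> 'rV[R]_m).
Local Notation Gam := (christoffel G).
Implicit Types (x X Y Z u v : 'rV[R]_n).

Lemma lie_bracket_cst (k : nat) (a b : 'rV[R]_k) : lie_bracket (cst a) (cst b) = cst 0.
Proof. by apply/funext => y; rewrite /lie_bracket !derive_cst subrr. Qed.

Lemma levi_civita_curvatureE (z a b c : 'rV[R]_m) : differentiable G z ->
  curvature_at (levi_civita G) z a b c =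
  'D_a (fun y => Gam y b c) z + Gam z a (Gam z b c)
  - ('D_b (fun y => Gam y a c) z + Gam z b (Gam z a c)).
Proof.
move=> dG.
have E (u v : 'rV[R]_m) : levi_civita G (cst u) (cst v) = (fun y => Gam y u v).
  by apply/funext => y; rewrite /levi_civita derive_cst add0r.
have E0 : Gam z 0 c = 0 by have := christoffelZl 0 0 c dG; rewrite !scale0r.
rewrite /curvature_at /curvature lie_bracket_cst.
by rewrite (E a c) (E b c) (E 0 c) E0 subr0.
Qed.

Variable q : 'rV[R]_n.
Hypothesis regF : \forall y \near q, regular_map_at F y.
Hypothesis regG : \forall z \near F q, regular_metric_at G z.
Let dF : differentiable F q. Proof. by have [] := nbhs_singleton regF. Qed.
Let dG : differentiable G (F q). Proof. by have [] := nbhs_singleton regG. Qed.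

Let derive_push_near u v : \forall y \near q,
  'D_u ('D_v F) y = 'D_u (fun y => push F y v) y.
Proof.
apply: filterS (nbhs_interior regF) => y ry; exact/esym/derive_push.
Qed.

Lemma differentiable_derive_push u v :
  differentiable ('D_u (fun y => push F y v)) q.
Proof.
apply: near_eq_differentiable (derive_push_near u v) _.
by have [_ _ ddd] := nbhs_singleton regF.
Qed.

(** [push F y Z] is itself a derivative of [F]; this is symmetry of the second
derivatives of ['D_Z F]. *)
Lemma derive2_pushC X Y Z :
  'D_X ('D_Y (fun y => push F y Z)) q = 'D_Y ('D_X (fun y => push F y Z)) q.
Proof.
have [_ dd ddd] := nbhs_singleton regF.
apply: (etrans (esym (near_eq_derive X (derive_push_near Y Z)))).
apply: (etrans _ (near_eq_derive Y (derive_push_near X Z))).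
apply: derive_commute => //.
by apply: filterS regF => y [].
Qed.

Lemma differentiable_lc_along_push Y Z :
  differentiable (lc_along G F Y (fun y => push F y Z)) q.
Proof.
apply: differentiableD; first exact: differentiable_derive_push.
by apply: differentiable_christoffel_along => //; exact: differentiable_push.
Qed.

(** The curvature of a pull-back connection is the pull-back of the curvature.
In the commutator the mixed first-order terms cancel in pairs; what is left are
the derivatives of the Christoffel symbols, taken by the chain rule in the pushed
directions, and their commutator. *)
Lemma lc_along_curvature X Y Z (W := fun y => push F y Z) :
  lc_along G F X (lc_along G F Y W) q - lc_along G F Y (lc_along G F X W) q =
  curvature_at (levi_civita G) (F q) (push F q X) (push F q Y) (push F q Z).
Proof.
have dP u := differentiable_push u regF.
have E A B : lc_along G F A (lc_along G F B W) q =
    'D_A ('D_B W) q + ('D_(push F q A) (fun y => Gam y (push F q B) (W q)) (F q)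
    + Gam (F q) ('D_A (fun y => push F y B) q) (W q)
    + Gam (F q) (push F q B) ('D_A W q))
    + (Gam (F q) (push F q A) ('D_B W q)
    + Gam (F q) (push F q A) (Gam (F q) (push F q B) (W q))).
  apply: (congr2 +%R _ (christoffelDr _ _ _ dG)).
  have d1 : derivable _ q A := diff_derivable (differentiable_derive_push B Z).
  have d2 : derivable _ q A := diff_derivable
    (differentiable_christoffel_along dF (dP B) (dP Z) regG).
  apply: (etrans (deriveD d1 d2)); apply: congr1.
  apply: (etrans (derive_christoffel_along dF (dP B) (dP Z) regG A)).
  by rewrite (pushE A dF).
apply: (etrans (congr2 (fun a b => a - b) (E X Y) (E Y X))).
apply: (etrans _ (esym (levi_civita_curvatureE _ _ _ dG))).
have cancel (a a' g g' p p' r s t t' : 'rV[R]_m) : a = a' -> g = g' ->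
    a + (p + g + r) + (s + t) - (a' + (p' + g' + s) + (r + t')) = p + t - (p' + t').
  by move=> -> ->; apply/rowP => k; rewrite !mxE; ring.
apply: cancel; first exact: derive2_pushC.
exact: (congr1 (fun a => Gam (F q) a _) (derive_pushC X Y regF)).
Qed.

End LeviCivitaCurvature.

(** * Tangential and normal parts *)

Section TangentNormal.
Context {R : realType} {n m : nat}.
Variables (G : 'rV[R]_m -> 'M[R]_m) (F : 'rV[R]_n -> 'rV[R]_m) (y : 'rV[R]_n).
Implicit Types (u v : 'rV[R]_n) (w : 'rV[R]_m).

Lemma bil_push u v :
  bil (G (F y)) (push F y u) (push F y v) = bil (induced_metric G F y) u v.
Proof. by rewrite /bil /push /induced_metric trmx_mul !mulmxA. Qed.

Lemma tangent_compD w w' :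
  tangent_comp G F y (w + w') = tangent_comp G F y w + tangent_comp G F y w'.
Proof. by rewrite /tangent_comp !mulmxDl. Qed.

Lemma tangent_compZ a w : tangent_comp G F y (a *: w) = a *: tangent_comp G F y w.
Proof. by rewrite /tangent_comp -!scalemxAl. Qed.

Lemma normal_partD w w' :
  normal_part G F y (w + w') = normal_part G F y w + normal_part G F y w'.
Proof. by rewrite /normal_part tangent_compD pushD opprD addrACA. Qed.

Lemma normal_partZ a w : normal_part G F y (a *: w) = a *: normal_part G F y w.
Proof. by rewrite /normal_part tangent_compZ pushZ scalerBr. Qed.

Hypothesis unitI : induced_metric G F y \in unitmx.

(** [tangent_comp] is the adjoint of [push], which makes [normal_part] orthogonal
to the tangent space. *)
Lemma bil_tangent_comp w v :
  bil (induced_metric G F y) (tangent_comp G F y w) v = bil (G (F y)) w (push F y v).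
Proof.
by rewrite /bil /tangent_comp mulmxKV// /push trmx_mul !mulmxA.
Qed.

Lemma bil_normal_push w v : bil (G (F y)) (normal_part G F y w) (push F y v) = 0.
Proof. by rewrite /normal_part bilBl bil_push bil_tangent_comp subrr. Qed.

Lemma bil_normal_part w w' :
  bil (G (F y)) (normal_part G F y w) w' =
  bil (G (F y)) (normal_part G F y w) (normal_part G F y w').
Proof.
rewrite -{1}(subrK (push F y (tangent_comp G F y w')) w') bilDr.
by rewrite bil_normal_push addr0.
Qed.

Lemma normal_part_push u : normal_part G F y (push F y u) = 0.
Proof.
rewrite /normal_part; suff -> : tangent_comp G F y (push F y u) = u by rewrite subrr.
have -> : tangent_comp G F y (push F y u) =
    u *m induced_metric G F y *m invmx (induced_metric G F y).
  by rewrite /tangent_comp /push /induced_metric !mulmxA.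
by rewrite mulmxK.
Qed.

End TangentNormal.

(** * The Gauss equation *)

Section Gauss.
Context {R : realType} {n m : nat}.
Variables (G : 'rV[R]_m -> 'M[R]_m) (phi : 'rV[R]_m -> 'cV[R]_m).
Variable F : 'rV[R]_n -> 'rV[R]_m.
Variable q : 'rV[R]_n.
Implicit Types (x X Y Z T u v : 'rV[R]_n) (V W N : 'rV[R]_n -> 'rV[R]_m).

Local Notation lc := (lc_along G F).
Local Notation g := (bil (G (F q))).
Local Notation gM := (bil (induced_metric G F q)).
Local Notation W_ Z := (fun y => push F y Z).

Lemma ssnm_alongE X V x : ssnm_along G phi F (cst X) V x =
  lc X V x + pairing (phi (F x)) (V x) *: push F x X.
Proof. by []. Qed.

Hypothesis regF : \forall y \near q, regular_map_at F y.
Hypothesis regG : \forall z \near F q, regular_metric_at G z.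
Hypothesis dphi : differentiable phi (F q).
Hypothesis unitI : \forall y \near q, induced_metric G F y \in unitmx.

Let dF : differentiable F q. Proof. by have [] := nbhs_singleton regF. Qed.
Let dG : differentiable G (F q). Proof. by have [] := nbhs_singleton regG. Qed.
Let uI : induced_metric G F q \in unitmx. Proof. exact: nbhs_singleton unitI. Qed.
Let dP u : differentiable (W_ u) q. Proof. exact: differentiable_push. Qed.

Lemma lc_alongD X V W : differentiable V q -> differentiable W q ->
  lc X (fun y => V y + W y) q = lc X V q + lc X W q.
Proof.
move=> dV dW; rewrite /lc_along christoffelDr//.
have dV' : derivable V q X := diff_derivable dV.
have dW' : derivable W q X := diff_derivable dW.
by rewrite [X in X + _](deriveD dV' dW') addrACA.
Qed.

Lemma lc_alongZ X (a : 'rV[R]_n -> R) V : differentiable a q -> differentiable V q ->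
  lc X (fun y => a y *: V y) q = 'D_X a q *: V q + a q *: lc X V q.
Proof.
move=> da dV; rewrite /lc_along christoffelZr// scalerDr.
by rewrite [X in X + _](derive_scalemx _ da dV) addrA.
Qed.

Lemma lc_alongB X V W : differentiable V q -> differentiable W q ->
  lc X (fun y => V y - W y) q = lc X V q - lc X W q.
Proof.
move=> dV dW; have dN : differentiable (fun y => (-1 : R) *: W y) q.
  by apply: (differentiable_scalemx (differentiable_cst _ _) dW).
have -> : (fun y => V y - W y) = (fun y => V y + (-1) *: W y).
  by apply/funext => y; rewrite scaleN1r.
rewrite (lc_alongD X dV dN) (lc_alongZ X (differentiable_cst _ _) dW).
by rewrite derive_cst scale0r add0r scaleN1r.
Qed.

Lemma differentiable_jacobian : differentiable (fun y => 'J F y) q.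
Proof.
apply/differentiable_mxP => i k.
have -> : (fun y => 'J F y i k) = (fun y => push F y (delta_mx 0 i) 0 k).
  by apply/funext => y; rewrite /push -rowE [RHS]mxE.
exact: ((differentiable_mxP _ _).1 (dP (delta_mx 0 i))).
Qed.

Lemma differentiable_normal_part V : differentiable V q ->
  differentiable (fun y => normal_part G F y (V y)) q.
Proof.
move=> dV; have dJ := differentiable_jacobian; have dJT := differentiable_trmx dJ.
have dGF := differentiable_metric_along regF regG.
have dI : differentiable (induced_metric G F) q.
  exact: (differentiable_mulmx (differentiable_mulmx dJ dGF) dJT).
apply: differentiableB => //; apply: differentiable_mulmx => //.
apply: differentiable_mulmx; last exact: differentiable_invmx.
exact: (differentiable_mulmx (differentiable_mulmx dV dGF) dJT).
Qed.

Let dphW W : differentiable W q ->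
  differentiable (fun y => pairing (phi (F y)) (W y)) q.
Proof. by apply: differentiable_pairing; exact: (differentiable_comp dF dphi). Qed.

Lemma differentiable_ssnm_push Y Z :
  differentiable (ssnm_along G phi F (cst Y) (W_ Z)) q.
Proof.
apply: differentiableD; first exact: differentiable_lc_along_push.
by apply: (differentiable_scalemx _ (dP Y)); exact: dphW.
Qed.

Lemma differentiable_sff Y Z : differentiable (fun y => sff G phi F y Y Z) q.
Proof. exact: differentiable_normal_part (differentiable_ssnm_push Y Z). Qed.

(** The two connections have the same second fundamental form, as phi(Y) X is
tangent. *)
Lemma sff_lc X Y : sff G phi F q X Y = normal_part G F q (lc X (W_ Y) q).
Proof.
rewrite /sff /ambient_derivative ssnm_alongE normal_partD normal_partZ.
by rewrite normal_part_push// scaler0 addr0.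
Qed.

Lemma sffC X Y : sff G phi F q X Y = sff G phi F q Y X.
Proof.
apply: (etrans (sff_lc X Y)); apply: (etrans _ (esym (sff_lc Y X))).
exact: (congr1 _ (lc_along_pushC regF regG X Y)).
Qed.

Lemma sffDr X Y Z : sff G phi F q X (Y + Z) = sff G phi F q X Y + sff G phi F q X Z.
Proof.
apply: (etrans (sff_lc X _)).
apply: (etrans _ (esym (congr2 +%R (sff_lc X Y) (sff_lc X Z)))).
rewrite -normal_partD; congr (normal_part _ _ _ _).
have -> : W_ (Y + Z) = (fun y => push F y Y + push F y Z).
  by apply/funext => y; exact: pushD.
exact: (lc_alongD X (dP Y) (dP Z)).
Qed.

Lemma sffZr X a Y : sff G phi F q X (a *: Y) = a *: sff G phi F q X Y.
Proof.
apply: (etrans (sff_lc X _)); apply: (etrans _ (esym (congr1 _ (sff_lc X Y)))).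
rewrite -normal_partZ; congr (normal_part _ _ _ _).
have -> : W_ (a *: Y) = (fun y => cst a y *: push F y Y).
  by apply/funext => y; exact: pushZ.
rewrite (lc_alongZ X (differentiable_cst _ _) (dP Y)).
by rewrite derive_cst scale0r add0r.
Qed.

(** Differentiate <N, T> = 0 for a normal field [N] and a tangent field [T]. *)
Lemma weingarten X T N : differentiable N q ->
  (\forall y \near q, forall u, bil (G (F y)) (N y) (push F y u) = 0) ->
  g (lc X N q) (push F q T) = - g (N q) (normal_part G F q (lc X (W_ T) q)).
Proof.
move=> dN N0; have := lc_along_metric regF regG X dN (dP T).
have -> : 'D_X (fun y => bil (G (F y)) (N y) (push F y T)) q = 0.
  have N0T : \forall y \near q, bil (G (F y)) (N y) (push F y T) = cst 0 y.
    by apply: filterS N0 => y ->.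
  by apply: (etrans (near_eq_derive X N0T)); exact: derive_cst.
move=> /eqP; rewrite eq_sym addr_eq0 => /eqP ->; congr (- _).
by rewrite /normal_part bilBr (nbhs_singleton N0) subr0.
Qed.

(** The definition of [s], read along the submanifold. *)
Lemma derive_form_push X Z :
  'D_X (fun y => pairing (phi (F y)) (push F y Z)) q =
  s_tensor G phi (F q) (push F q X) (push F q Z)
  + pairing (phi (F q)) (lc X (W_ Z) q)
  + pairing (phi (F q)) (push F q X) * pairing (phi (F q)) (push F q Z).
Proof.
have dphF := differentiable_comp dF dphi.
rewrite (derive_pairing X dphF (dP Z)) (derive_comp X dF dphi) -(pushE X dF).
rewrite /s_tensor (derive_pairing _ dphi (differentiable_cst _ _)).
rewrite /levi_civita !derive_cst add0r /lc_along pairingD.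
rewrite /cst; have -> : pairing (phi (F q)) 0 = 0 by rewrite /pairing mul0mx mxE.
ring.
Qed.

(** Expanding both iterated derivatives with [derive_form_push], the terms that
are not in the curvature or in [s] cancel because the torsion vanishes. *)
Lemma ssnm_along_curvature X Y Z :
  ssnm_along G phi F (cst X) (ssnm_along G phi F (cst Y) (W_ Z)) q
  - ssnm_along G phi F (cst Y) (ssnm_along G phi F (cst X) (W_ Z)) q
  = curvature_at (levi_civita G) (F q) (push F q X) (push F q Y) (push F q Z)
  + s_tensor G phi (F q) (push F q X) (push F q Z) *: push F q Y
  - s_tensor G phi (F q) (push F q Y) (push F q Z) *: push F q X.
Proof.
rewrite -(lc_along_curvature regF regG).
have E A B : ssnm_along G phi F (cst A) (ssnm_along G phi F (cst B) (W_ Z)) q =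
   lc A (lc B (W_ Z)) q
   + ((s_tensor G phi (F q) (push F q A) (push F q Z)
      + pairing (phi (F q)) (lc A (W_ Z) q)
      + pairing (phi (F q)) (push F q A) * pairing (phi (F q)) (push F q Z))
       *: push F q B
     + pairing (phi (F q)) (push F q Z) *: lc A (W_ B) q)
   + (pairing (phi (F q)) (lc B (W_ Z) q)
     + pairing (phi (F q)) (push F q Z) * pairing (phi (F q)) (push F q B))
       *: push F q A.
  rewrite ssnm_alongE; congr (_ + _ *: _).
    rewrite -derive_form_push -(lc_alongZ A (dphW (dP Z)) (dP B)).
    apply: lc_alongD; first exact: differentiable_lc_along_push.
    exact: (differentiable_scalemx (dphW (dP Z)) (dP B)).
  by rewrite ssnm_alongE pairingD pairingZ.
have cancel (a b u v e e' : 'rV[R]_m) (s t c d p r z : R) : e = e' ->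
    a + ((s + c + p * z) *: u + z *: e) + (d + z * r) *: v
    - (b + ((t + d + r * z) *: v + z *: e') + (c + z * p) *: u)
    = a - b + s *: u - t *: v.
  by move=> ->; apply/rowP => k; rewrite !mxE; ring.
apply: (etrans (congr2 (fun a b => a - b) (E X Y) (E Y X))).
exact: (cancel _ _ _ _ _ _ _ _ _ _ _ _ _ (lc_along_pushC regF regG X Y)).
Qed.

Lemma induced_connectionE Y Z :
  (fun y => push F y (induced_connection G phi F (cst Y) (cst Z) y))
  = (fun y => ssnm_along G phi F (cst Y) (W_ Z) y - sff G phi F y Y Z).
Proof. by apply/funext => y; rewrite /sff /normal_part opprB addrC subrK. Qed.

Lemma bil_induced_connection2 X Y Z T :
  gM (induced_connection G phi F (cst X)
    (induced_connection G phi F (cst Y) (cst Z)) q) T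
  = g (ssnm_along G phi F (cst X) (ssnm_along G phi F (cst Y) (W_ Z)) q) (push F q T)
    + g (sff G phi F q Y Z) (sff G phi F q X T)
    - pairing (phi (F q)) (sff G phi F q Y Z) * gM X T.
Proof.
apply: (etrans (bil_tangent_comp uI _ _)).
rewrite /ambient_derivative induced_connectionE.
set V := ssnm_along G phi F (cst Y) _; set N := fun y => sff G phi F y Y Z.
have dV : differentiable V q by exact: differentiable_ssnm_push.
have dN : differentiable N q by exact: differentiable_sff.
have E : ssnm_along G phi F (cst X) (fun y => V y - N y) q =
    lc X V q - lc X N q
    + (pairing (phi (F q)) (V q) - pairing (phi (F q)) (N q)) *: push F q X.
  by rewrite -pairingB -lc_alongB.
have split (A : 'M[R]_m) (a b w t : 'rV[R]_m) (r s : R) :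
    bil A (a - b + (r - s) *: w) t =
    bil A (a + r *: w) t - bil A b t - s * bil A w t.
  by rewrite !bilDl bilNl !bilZl; ring.
apply: (etrans (congr1 (fun w => g w (push F q T)) E)).
apply: (etrans (split _ _ _ _ _ _ _)); rewrite bil_push.
congr (_ - _); congr (_ + _).
have N0 : \forall y \near q, forall u, bil (G (F y)) (N y) (push F y u) = 0.
  by apply: filterS unitI => y uy u; exact: bil_normal_push.
by rewrite (weingarten X T dN N0) opprK (sff_lc X T).
Qed.

(** The tangential part of the ambient curvature, corrected by the derivatives of
the normal fields sigma(Y, Z) and sigma(X, Z), which [weingarten] evaluates. The
last two terms come from phi(sigma) X in the derivative of a normal field. *)
Lemma gauss_equation X Y Z T :
  R_induced G phi F q X Y Z T =
  g (curvature_at (levi_civita G) (F q) (push F q X) (push F q Y) (push F q Z))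
    (push F q T)
  + s_tensor G phi (F q) (push F q X) (push F q Z) * gM Y T
  - s_tensor G phi (F q) (push F q Y) (push F q Z) * gM X T
  + g (sff G phi F q Y Z) (sff G phi F q X T)
  - g (sff G phi F q X Z) (sff G phi F q Y T)
  - pairing (phi (F q)) (sff G phi F q Y Z) * gM X T
  + pairing (phi (F q)) (sff G phi F q X Z) * gM Y T.
Proof.
have N0 : induced_connection G phi F (cst 0) (cst Z) q = 0.
  rewrite /induced_connection /ambient_derivative ssnm_alongE.
  rewrite /lc_along derive0 /push !mul0mx scaler0 addr0 add0r.
  have := christoffelZl 0 0 (Z *m 'J F q) dG; rewrite !scale0r => ->.
  by rewrite /tangent_comp !mul0mx.
have H := congr1 (fun w => g w (push F q T)) (ssnm_along_curvature X Y Z).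
have split (A : 'M[R]_m) (a b r u v t : 'rV[R]_m) (s s' : R) :
    bil A (a - b) t = bil A (r + s *: u - s' *: v) t ->
    bil A a t = bil A r t + s * bil A u t - s' * bil A v t + bil A b t.
  by rewrite !bilBl bilDl !bilZl => <-; rewrite subrK.
have {H}H := split _ _ _ _ _ _ _ _ _ H.
rewrite /R_induced /curvature_at /curvature lie_bracket_cst N0 subr0 bilBl.
apply: (etrans (congr2 (fun a b => a - b) (bil_induced_connection2 X Y Z T)
  (bil_induced_connection2 Y X Z T))).
have fin (a b c s s' x y k l k' l' : R) : a = c + s * y - s' * x + b ->
   a + k - l * x - (b + k' - l' * y) =
   c + s * y - s' * x + k - k' - l * x + l' * y.
  by move=> ->; ring.
by apply: fin; rewrite -!bil_push.
Qed.

End Gauss.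

(** * Orthonormal frames and the algebraic inequality *)

Section OrthonormalFrames.
Context {R : realType} {n : nat}.
Variable A : 'M[R]_n.
Hypothesis symA : A^T = A.

Lemma orthonormal_expand (e : 'I_n -> 'rV[R]_n) (v : 'rV[R]_n) :
  orthonormal_basis A e -> v = \sum_k bil A v (e k) *: e k.
Proof.
move=> on; pose E : 'M[R]_n := \matrix_(k < n) e k.
have rE k : row k E = e k by rewrite rowK.
have EAE : E *m (A *m E^T) = 1%:M.
  apply/matrixP => k l; rewrite [RHS]mxE -(on k l) mulmxA /bil -(rE k) -(rE l).
  by rewrite tr_row colE !mulmxA -colE -!row_mul [RHS]mxE [RHS]mxE.
rewrite -[LHS]mulmx1 -(mulmx1C EAE) mulmxA mulmx_sum_row; apply: eq_bigr => k _.
rewrite rE; congr (_ *: _).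
by rewrite /bil -(rE k) tr_row colE !mulmxA -colE [RHS]mxE.
Qed.

Lemma linear_sum_scale (V : lmodType R) (f : 'rV[R]_n -> V) (I : finType) (a : I -> R)
    (u : I -> 'rV[R]_n) :
  linear f -> f (\sum_i a i *: u i) = \sum_i a i *: f (u i).
Proof.
move=> lf; have f0 : f 0 = 0.
  by have := lf (-1) 0 0; rewrite scaler0 addr0 scaleN1r addNr.
by elim/big_rec2: _ => [//|i x y _ <-]; rewrite lf.
Qed.

(** The matrix of coefficients of one frame on the other is orthogonal. *)
Lemma trace_orthonormal (V : lmodType R) (B : 'rV[R]_n -> 'rV[R]_n -> V)
    (e b : 'I_n -> 'rV[R]_n) :
  (forall v, linear (B^~ v)) -> (forall u, linear (B u)) ->
  orthonormal_basis A e -> orthonormal_basis A b ->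
  \sum_k B (e k) (e k) = \sum_k B (b k) (b k).
Proof.
move=> ll lr oe ob.
have bE k : B (b k) (b k) =
    \sum_a \sum_c (bil A (b k) (e a) * bil A (b k) (e c)) *: B (e a) (e c).
  have bk := orthonormal_expand (b k) oe.
  have -> : B (b k) (b k) = \sum_a bil A (b k) (e a) *: B (e a) (b k).
    by rewrite -(linear_sum_scale _ _ (ll (b k))) -bk.
  apply: eq_bigr => a _; rewrite {2}bk (linear_sum_scale _ _ (lr _)) scaler_sumr.
  by apply: eq_bigr => c _; rewrite scalerA.
rewrite [RHS](eq_bigr _ (fun k _ => bE k)) exchange_big; apply: eq_bigr => a _.
rewrite exchange_big /= (bigD1 a)//= -scaler_suml.
have O c : \sum_k bil A (b k) (e a) * bil A (b k) (e c) = (a == c)%:R.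
  rewrite -(oe a c) [in RHS](orthonormal_expand (e a) ob) bil_suml.
  by apply: eq_bigr => k _; rewrite bilZl (bilC (b k))// (bilC _ (e a))// symA.
rewrite O eqxx scale1r big1 ?addr0// => c ca.
by rewrite -scaler_suml O eq_sym (negPf ca) scale0r.
Qed.

End OrthonormalFrames.

Section InnerProduct.
Context {R : realType} {m : nat}.
Variable A : 'M[R]_m.
Hypothesis symA : A^T = A.
Hypothesis posA : forall u : 'rV[R]_m, u != 0 -> 0 < bil A u u.
Implicit Types u v : 'rV[R]_m.

Lemma bil_ge0 u : 0 <= bil A u u.
Proof. by have [->|/posA/ltW//] := eqVneq u 0; rewrite bil0l. Qed.

Lemma vnorm_sqr u : vnorm A u ^+ 2 = bil A u u.
Proof. by rewrite sqr_sqrtr// bil_ge0. Qed.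

(** Positivity of the form on <v, v> u - <u, v> v. *)
Lemma cauchy_schwarz u v : bil A u v ^+ 2 <= bil A u u * bil A v v.
Proof.
have [->|v0] := eqVneq v 0; first by rewrite bil0r expr0n bil0l mulr0.
have := bil_ge0 (bil A v v *: u - bil A u v *: v).
rewrite !bilBl !bilBr !bilZl !bilZr (bilC v u)//.
set a := bil A u u; set b := bil A u v; set c := bil A v v => H.
have c0 : 0 < c by exact: posA.
rewrite -(ler_pM2l c0) -subr_ge0; apply: le_trans H _.
by rewrite le_eqVlt; apply/orP; left; apply/eqP; ring.
Qed.

End InnerProduct.

Section RicciAlgebra.
Context {R : realType} {n m : nat}.
Variable A : 'M[R]_m.
Hypothesis symA : A^T = A.
Hypothesis posA : forall u : 'rV[R]_m, u != 0 -> 0 < bil A u u.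
Hypothesis n_ge2 : (2 <= n)%N.
Variable S : 'I_n -> 'I_n -> 'rV[R]_m.
Hypothesis symS : forall k l, S k l = S l k.

Local Notation g := (bil A).
Let i0 : 'I_n := Ordinal (ltnW n_ge2).
Variable H : 'rV[R]_m.
Hypothesis HE : H = n%:R^-1 *: \sum_k S k k.
Let h := vnorm A H.
Let Stot := \sum_k \sum_l g (S k l) (S k l).
Let N : R := n%:R.

(** The part of the Ricci curvature of the first frame vector that comes from
the second fundamental form, [S k l] standing for sigma(e_k, e_l). *)
Definition extrinsic_ricci : R :=
  \sum_(j < n | (0 < j)%N) (g (S i0 i0) (S j j) - g (S i0 j) (S i0 j)).

Let i0P (j : 'I_n) : (j != i0) = (0 < j)%N.
Proof. by rewrite lt0n. Qed.

Let N2 : 2 <= N. Proof. by rewrite /N ler_nat. Qed.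
Let N0 : 0 < N. Proof. by apply: lt_le_trans N2. Qed.
Let N1 : 0 < N - 1. Proof. have := N2; lra. Qed.
Let cardN1 : (\sum_(j < n | (0 < j)%N) (1 : R)) = N - 1.
Proof.
have : \sum_(j < n) (1 : R) = N by rewrite sumr_const card_ord.
rewrite (bigD1 i0)//= => <-; rewrite addrAC subrr add0r.
by apply: eq_bigl => j; rewrite i0P.
Qed.

Let gamma := \sum_(j < n | (0 < j)%N) g (S i0 j) (S i0 j).
Let b k := S k k - H.
Let beta := g (b i0) (b i0).

Let gamma_ge0 : 0 <= gamma.
Proof. by apply: sumr_ge0 => j _; exact: bil_ge0. Qed.

Let sumS : \sum_k S k k = N *: H.
Proof. by rewrite HE scalerA divff ?scale1r// gt_eqF. Qed.

Let sumSpos : \sum_(j < n | (0 < j)%N) S j j = N *: H - S i0 i0.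
Proof.
rewrite -sumS [X in _ = X - _](bigD1 i0)//= [RHS]addrAC subrr add0r.
by apply: eq_bigl => j; rewrite i0P.
Qed.

Lemma extrinsic_ricciE : extrinsic_ricci = g (S i0 i0) (N *: H - S i0 i0) - gamma.
Proof. by rewrite -sumSpos bil_sumr -sumrB. Qed.

(** Completing the square: |S_00 - n H / 2|^2 is nonnegative. *)
Lemma extrinsic_ricci_le : extrinsic_ricci <= N ^+ 2 / 4 * h ^+ 2.
Proof.
rewrite extrinsic_ricciE vnorm_sqr//.
have := bil_ge0 posA (S i0 i0 - (N / 2) *: H).
rewrite !bilBl !bilBr !bilZl !bilZr (bilC H (S i0 i0))//.
have := gamma_ge0; move: (g _ _) (g _ _) (g _ _) gamma => x y z t t0 sq.
nra.
Qed.

Let sumb : \sum_k b k = 0.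
Proof.
rewrite sumrB sumS sumr_const card_ord /N scaler_nat.
by rewrite subrr.
Qed.

Let sumbpos : \sum_(j < n | (0 < j)%N) b j = - b i0.
Proof.
have -> : \sum_(j < n | (0 < j)%N) b j = \sum_(j | j != i0) b j.
  by apply: eq_bigl => j; rewrite i0P.
have := sumb; rewrite (bigD1 i0)//= => /eqP.
by rewrite addrC addr_eq0 => /eqP.
Qed.

Let bil_sqrD u v : g (u + v) (u + v) = g u u + (2 * g u v + g v v).
Proof. by rewrite !bilDl !bilDr (bilC v u)//; ring. Qed.

Let Sdiag : \sum_k g (S k k) (S k k) = \sum_k g (b k) (b k) + N * g H H.
Proof.
have E k : g (S k k) (S k k) = g (b k) (b k) + (2 * g (b k) H + g H H).
  by rewrite -bil_sqrD subrK.
rewrite (eq_bigr _ (fun k _ => E k)) big_split; congr (_ + _).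
rewrite big_split /= -mulr_sumr -bil_suml sumb bil0l mulr0 add0r.
by rewrite sumr_const card_ord mulr_natl.
Qed.

(** The mean of the [b j] with j > 0 is [- b i0] over n - 1, so this says that the
sum of the squared deviations from it is nonnegative. *)
Let diag_ge : N / (N - 1) * beta <= \sum_k g (b k) (b k).
Proof.
rewrite (bigD1 i0)//= -/beta.
have -> : \sum_(j | j != i0) g (b j) (b j) = \sum_(j < n | (0 < j)%N) g (b j) (b j).
  by apply: eq_bigl => j; rewrite i0P.
pose r := (N - 1)^-1.
have : 0 <= \sum_(j < n | (0 < j)%N) g (b j + r *: b i0) (b j + r *: b i0).
  by apply: sumr_ge0 => j _; exact: bil_ge0.
have E j : g (b j + r *: b i0) (b j + r *: b i0) =
    g (b j) (b j) + (2 * r * g (b j) (b i0) + r ^+ 2 * beta * 1).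
  by rewrite bil_sqrD bilZl !bilZr /beta; ring.
rewrite (eq_bigr _ (fun k _ => E k)) big_split /= big_split /= -!mulr_sumr.
rewrite -bil_suml sumbpos cardN1 bilNl -/beta.
move: (\sum_(i < n | _) _) => s.
have -> : 2 * r * - beta + r ^+ 2 * beta * (N - 1) = - (r * beta).
  by rewrite /r; field; rewrite gt_eqF.
have -> : N / (N - 1) * beta = beta + r * beta.
  by rewrite /r; field; rewrite gt_eqF.
by rewrite subr_ge0 lerD2l.
Qed.

(** Every [S i0 j] with j > 0 also occurs as [S j i0]. *)
Let Stot_ge : \sum_k g (S k k) (S k k) + 2 * gamma <= Stot.
Proof.
have gE : gamma = \sum_(j | j != i0) g (S i0 j) (S i0 j).
  by apply: eq_bigl => j; rewrite i0P.
rewrite /Stot (bigD1 i0)//= [leRHS](bigD1 i0)//= [X in _ <= X + _](bigD1 i0)//= -gE.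
have : \sum_(k | k != i0) (g (S i0 k) (S i0 k) + g (S k k) (S k k)) <=
    \sum_(k | k != i0) \sum_l g (S k l) (S k l).
  apply: ler_sum => k k0; rewrite (bigD1 i0)//= (bigD1 k)//= (symS k i0) addrA.
  by rewrite lerDl; apply: sumr_ge0 => j _; exact: bil_ge0.
by rewrite big_split /= -gE; lra.
Qed.

(** With [T] the squared norm of the trace-free part, beta + gamma <=
(N - 1) / N * T bounds at once the quadratic terms and, through Cauchy-Schwarz,
the term in <H, b_0>. *)
Lemma calH_le_extrinsic_ricci : calH n h (Num.sqrt Stot) <= extrinsic_ricci.
Proof.
have Stot0 : 0 <= Stot.
  by apply: sumr_ge0 => k _; apply: sumr_ge0 => l _; exact: bil_ge0.
rewrite extrinsic_ricciE /calH -/N (sqr_sqrtr Stot0).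
have h2 : h ^+ 2 = g H H by rewrite /h vnorm_sqr.
have h0 : 0 <= h by exact: sqrtr_ge0.
pose T := Stot - N * h ^+ 2.
have beta0 : 0 <= beta by exact: bil_ge0.
have TB : N / (N - 1) * (beta + gamma) <= T.
  (* The off-diagonal entries count twice, and this is where n >= 2 enters. *)
  have n2 : N / (N - 1) <= 2 by rewrite ler_pdivrMr//; have := N2; lra.
  have : N / (N - 1) * gamma <= 2 * gamma by rewrite ler_wpM2r.
  have := diag_ge; have := Stot_ge; rewrite Sdiag -h2 mulrDr /T; lra.
have BT : beta + gamma <= (N - 1) / N * T.
  have -> : beta + gamma = (N - 1) / N * (N / (N - 1) * (beta + gamma)).
    by field; rewrite !gt_eqF.
  by rewrite ler_pM2l ?divr_gt0.
have T0 : 0 <= T.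
  by rewrite -(pmulr_rge0 _ (divr_gt0 N1 N0)); apply: le_trans BT; rewrite addr_ge0.
set tau := Num.sqrt _.
have tau0 : 0 <= tau by exact: sqrtr_ge0.
have tau2 : tau ^+ 2 = N * T / (N - 1).
  by apply: sqr_sqrtr; exact: (divr_ge0 (mulr_ge0 (ltW N0) T0) (ltW N1)).
pose x := h * ((N - 1) / N * tau).
have x0 : 0 <= x.
  exact: (mulr_ge0 h0 (mulr_ge0 (divr_ge0 (ltW N1) (ltW N0)) tau0)).
have gx : - x <= g H (b i0).
  suff : `|g H (b i0)| <= x by rewrite ler_norml => /andP[].
  rewrite -(@ler_pXn2r _ 2)// ?nnegrE// real_normK ?num_real//.
  apply: le_trans (cauchy_schwarz symA posA _ _) _; rewrite -h2 -/beta.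
  rewrite /x exprMn ler_wpM2l ?sqr_ge0// exprMn tau2.
  have -> : ((N - 1) / N) ^+ 2 * (N * T / (N - 1)) = (N - 1) / N * T.
    by field; rewrite !gt_eqF.
  by apply: le_trans BT; rewrite lerDl.
have -> : g (S i0 i0) (N *: H - S i0 i0) =
    (N - 1) * h ^+ 2 + (N - 2) * g H (b i0) - beta.
  have E u v : g (u + v) (N *: v - (u + v)) =
      (N - 1) * g v v + (N - 2) * g v u - g u u.
    by rewrite bilBr bil_sqrD bilZr bilDl (bilC u v)//; ring.
  by rewrite h2 /beta -E subrK.
have -> : (N - 1) / N * (2 * N * h ^+ 2 - Stot - (N - 2) * h * tau) =
    (N - 1) * h ^+ 2 - (N - 2) * x - (N - 1) / N * T.
  by rewrite /x /T; field; rewrite gt_eqF.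
have : (N - 2) * - x <= (N - 2) * g H (b i0).
  by rewrite ler_wpM2l// subr_ge0.
by move: BT; lra.
Qed.

End RicciAlgebra.

(** * Ricci curvature at a point *)

Section Pointwise.
Context {R : realType} {n m : nat}.
Variables (G : 'rV[R]_m -> 'M[R]_m) (phi : 'rV[R]_m -> 'cV[R]_m).
Variable F : 'rV[R]_n -> 'rV[R]_m.
Variable q : 'rV[R]_n.

Local Notation g := (bil (G (F q))).
Local Notation gM := (bil (induced_metric G F q)).
Local Notation sg := (sff G phi F q).

Hypothesis regF : \forall y \near q, regular_map_at F y.
Hypothesis regG : \forall z \near F q, regular_metric_at G z.
Hypothesis dphi : differentiable phi (F q).
Hypothesis unitI : \forall y \near q, induced_metric G F y \in unitmx.
Hypothesis posG : forall u : 'rV[R]_m, u != 0 -> 0 < g u u.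

Let dG : differentiable G (F q). Proof. by have [] := nbhs_singleton regG. Qed.
Let symG : (G (F q))^T = G (F q).
Proof. by have [] := nbhs_singleton regG. Qed.
Let unitG : G (F q) \in unitmx.
Proof. by have [] := nbhs_singleton regG. Qed.
Let uI : induced_metric G F q \in unitmx. Proof. exact: nbhs_singleton unitI. Qed.

Lemma s_tensorE u v : s_tensor G phi (F q) u v = pairing ('D_u phi (F q)) v
  - pairing (phi (F q)) (christoffel G (F q) u v)
  - pairing (phi (F q)) u * pairing (phi (F q)) v.
Proof.
rewrite /s_tensor (derive_pairing _ dphi (differentiable_cst _ _)).
rewrite /levi_civita !derive_cst add0r; congr (_ - _ - _).
by rewrite /cst [X in _ + X](_ : _ = 0) ?addr0// /pairing mul0mx mxE.
Qed.

Lemma linear_s_tensorl v :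
  linear (fun u => s_tensor G phi (F q) (push F q u) (push F q v) : R^o).
Proof.
move=> a u u'; rewrite !s_tensorE pushD pushZ.
rewrite (deriveDdir _ _ dphi) (deriveZdir _ _ dphi).
rewrite (christoffelDl _ _ _ dG) (christoffelZl _ _ _ dG) !pairingD !pairingZ.
rewrite /GRing.scale /=.
have E (x y : 'cV[R]_m) w : pairing (a *: x + y) w = a * pairing x w + pairing y w.
  by rewrite /pairing mulmxDr -scalemxAr !mxE.
rewrite E.
have comb (p p' r r' t t' s : R) : a * p + p' - (a * r + r') - (a * t + t') * s =
    a * (p - r - t * s) + (p' - r' - t' * s) by ring.
exact: comb.
Qed.

Lemma linear_s_tensorr u :
  linear (fun v => s_tensor G phi (F q) (push F q u) (push F q v) : R^o).
Proof.
move=> a v v'; rewrite !s_tensorE pushD pushZ.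
rewrite (christoffelDr _ _ _ dG) (christoffelZr _ _ _ dG) !pairingD !pairingZ.
have comb (p p' r r' t t' s : R) : a * p + p' - (a * r + r') - s * (a * t + t') =
    a * (p - r - s * t) + (p' - r' - s * t') by ring.
exact: comb.
Qed.

Lemma linear_sffr u : linear (sg u).
Proof.
move=> a v w; apply: (etrans (sffDr phi regF regG unitI u (a *: v) w)).
exact: (congr1 (fun x => x + _) (sffZr phi regF regG unitI u a v)).
Qed.

Lemma linear_sffl v : linear (sg^~ v).
Proof.
move=> a u w; have C := sffC phi regF regG unitI.
by rewrite (C _ v) (C u v) (C w v) linear_sffr.
Qed.

(** On normal vectors phi is the product with the normal part of its dual
vector. *)
Lemma pairing_sff u v : pairing (phi (F q)) (sg u v) = g (P_normal G phi F q) (sg u v).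
Proof.
have -> : pairing (phi (F q)) (sg u v) = g (dual_field G phi (F q)) (sg u v).
  rewrite (bilC _ _ symG) /bil /dual_field trmx_mul trmxK trmx_inv symG.
  by rewrite -mulmxA mulKVmx.
apply: (etrans (bilC _ _ symG)); apply: (etrans (bil_normal_part uI _ _)).
exact: (bilC _ _ symG).
Qed.

Variable c : R.
Hypothesis const_curv : forall X Y Z W : 'rV[R]_m,
  g (curvature_at (levi_civita G) (F q) X Y Z) W = c * (g X W * g Y Z - g X Z * g Y W).
Hypothesis n_ge2 : (2 <= n)%N.
Variables e b : 'I_n -> 'rV[R]_n.
Hypothesis orth_e : orthonormal_basis (induced_metric G F q) e.
Hypothesis orth_b : orthonormal_basis (induced_metric G F q) b.
Let i0 : 'I_n := Ordinal (ltnW n_ge2).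
Local Notation S := (fun k l => sg (b k) (b l)).

Let symI : (induced_metric G F q)^T = induced_metric G F q.
Proof. by rewrite /induced_metric !trmx_mul trmxK symG mulmxA. Qed.

Lemma ricci_term (j : 'I_n) : (0 < j)%N ->
  R_induced G phi F q (b i0) (b j) (b j) (b i0) =
  c - s_tensor G phi (F q) (push F q (b j)) (push F q (b j))
  - g (P_normal G phi F q) (S j j)
  + (g (S i0 i0) (S j j) - g (S i0 j) (S i0 j)).
Proof.
move=> j0; apply: (etrans (gauss_equation regF regG dphi unitI _ _ _ _)).
have comb (cv s1 z s2 o g1 g2 p1 p2 g1' g2' p' : R) : cv = c -> z = 0 -> o = 1 ->
    g1 = g1' -> g2 = g2' -> p1 = p' ->
    cv + s1 * z - s2 * o + g1 - g2 - p1 * o + p2 * z = c - s2 - p' + (g1' - g2').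
  by move=> -> -> -> -> -> ->; ring.
have ji : (j == i0) = false by apply/negbTE; rewrite -lt0n in j0 *.
have z : gM (b j) (b i0) = 0 by rewrite orth_b ji.
have z' : gM (b i0) (b j) = 0 by rewrite orth_b eq_sym ji.
have o k : gM (b k) (b k) = 1 by rewrite orth_b eqxx.
apply: comb.
- by rewrite const_curv !bil_push z z' !o mul0r subr0 !mulr1.
- exact: z.
- exact: o.
- exact: (bilC _ _ symG).
- exact: (congr1 (g _) (sffC phi regF regG unitI (b j) (b i0))).
- exact: pairing_sff.
Qed.

Lemma mean_curvature_frame : mean_curvature G phi F q e = n%:R^-1 *: \sum_k S k k.
Proof.
by congr (_ *: _); apply: (trace_orthonormal symI linear_sffl linear_sffr).
Qed.

Lemma trace_s_frame : trace_s G phi F q e =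
  \sum_k s_tensor G phi (F q) (push F q (b k)) (push F q (b k)).
Proof.
exact: (trace_orthonormal symI linear_s_tensorl linear_s_tensorr orth_e orth_b).
Qed.

Lemma norm_sff_frame : norm_sff G phi F q e =
  Num.sqrt (\sum_k \sum_l g (S k l) (S k l)).
Proof.
rewrite /norm_sff; congr Num.sqrt.
have E k l : vnorm (G (F q)) (sg (e k) (e l)) ^+ 2 = g (sg (e k) (e l)) (sg (e k) (e l)).
  exact: vnorm_sqr.
rewrite (eq_bigr _ (fun k _ => eq_bigr _ (fun l _ => E k l))).
have lin (f : 'rV[R]_n -> 'rV[R]_m) : linear f -> forall w,
    linear (fun u => g (f u) w : R^o) /\ linear (fun u => g w (f u) : R^o).
  by move=> lf w; split=> a u v; rewrite lf ?bilDl ?bilDr ?bilZl ?bilZr.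
have swap (f : 'I_n -> 'I_n -> R) : \sum_k \sum_l f k l = \sum_l \sum_k f k l.
  exact: exchange_big.
apply: (etrans (swap _)).
have tr (B : 'rV[R]_n -> 'rV[R]_n -> R) :
    (forall v, linear (B^~ v : _ -> R^o)) -> (forall u, linear (B u : _ -> R^o)) ->
    \sum_k B (e k) (e k) = \sum_k B (b k) (b k).
  by move=> ll lr; exact: (trace_orthonormal symI ll lr orth_e orth_b).
have E1 l := tr (fun u v => g (sg u (e l)) (sg v (e l)))
  (fun w => (lin _ (linear_sffl (e l)) (sg w (e l))).1)
  (fun w => (lin _ (linear_sffl (e l)) (sg w (e l))).2).
apply: (etrans (eq_bigr _ (fun l _ => E1 l))).
apply: (etrans (swap _)); apply: eq_bigr => k _.
exact: (tr (fun u v => g (sg (b k) u) (sg (b k) v))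
  (fun w => (lin _ (linear_sffr (b k)) (sg (b k) w)).1)
  (fun w => (lin _ (linear_sffr (b k)) (sg (b k) w)).2)).
Qed.

(** Only the sectional terms of [gauss_equation] survive on an orthonormal frame:
those with a factor <e_j, X> vanish. *)
Lemma ricciE : ricci G phi F q (b i0) b =
  Phi_ricci G phi F c q e (b i0) + extrinsic_ricci (G (F q)) n_ge2 S.
Proof.
have sub (f : 'I_n -> R) : \sum_(j < n | (0 < j)%N) f j = \sum_j f j - f i0.
  rewrite [X in _ = X - _](bigD1 i0)//= [RHS]addrAC subrr add0r.
  by apply: eq_bigl => j; rewrite lt0n.
have dist (s p d : 'I_n -> R) :
    \sum_(j < n | (0 < j)%N) (c - s j - p j + d j) =
    (n%:R - 1) * c - \sum_j s j + s i0 - \sum_j p j + p i0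
    + \sum_(j < n | (0 < j)%N) d j.
  by rewrite big_split /= !sumrB !sub sumr_const card_ord -mulr_natl; ring.
apply: (etrans (eq_bigr _ ricci_term)); apply: (etrans (dist _ _ _)).
apply: (congr1 (fun x => x + _)).
rewrite /Phi_ricci trace_s_frame mean_curvature_frame -/i0.
do 2! congr (_ + _); congr (- _).
rewrite bilZr mulrA divff ?mul1r ?bil_sumr// pnatr_eq0 -lt0n.
exact: ltnW n_ge2.
Qed.

Theorem ricci_bounds (X := b i0) (H := mean_curvature G phi F q e) :
  Phi_ricci G phi F c q e X + calH n (vnorm (G (F q)) H) (norm_sff G phi F q e)
    <= ricci G phi F q X b
    <= Phi_ricci G phi F c q e X + n%:R ^+ 2 / 4 * vnorm (G (F q)) H ^+ 2.
Proof.
have symS k l : S k l = S l k by exact: sffC.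
rewrite ricciE norm_sff_frame !lerD2l; apply/andP; split.
  exact: (calH_le_extrinsic_ricci symG posG n_ge2 symS mean_curvature_frame).
exact: (extrinsic_ricci_le symG posG n_ge2 mean_curvature_frame).
Qed.

End Pointwise.

(** * From charts to the pointwise statement *)

Section PositiveDefinite.
Context {R : realType}.

Lemma posdef_unitmx m (A : 'M[R]_m) :
  (forall u : 'rV[R]_m, u != 0 -> 0 < bil A u u) -> A \in unitmx.
Proof.
move=> pA; rewrite -row_free_unit -kermx_eq0; apply/negP => /negP.
rewrite -nz_row_eq0 => /pA; have /sub_kermxP := nz_row_sub (kermx A).
by rewrite /bil => ->; rewrite mul0mx mxE ltxx.
Qed.

Lemma induced_metric_unitmx n m (G : 'rV[R]_m -> 'M[R]_m) (F : 'rV[R]_n -> 'rV[R]_m) y :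
  (forall u, u != 0 -> 0 < bil (G (F y)) u u) -> row_free ('J F y) ->
  induced_metric G F y \in unitmx.
Proof.
move=> pG rJ; apply: posdef_unitmx => u u0; rewrite -bil_push; apply: pG.
by apply: contra_neq u0 => uJ; apply: (row_free_inj rJ); rewrite mul0mx.
Qed.

End PositiveDefinite.

Section Charts.
Context {R : realType}.

Lemma regular_metric_chart m (N : manifold R m) (g : metric N) j x :
  chart_dom j x -> regular_metric_at (g j) (chart_map j x).
Proof.
move=> jx; have dx : (chart_map j @` chart_dom j) (chart_map j x) by exists x.
have [dg ddg] := metric_smooth g j 2; split.
- exact: dg.
- by move=> u; have [+ _] := ddg u; exact.
- exact: (Defs.metric_sym g jx).
- by apply: posdef_unitmx => u; exact: metric_posdef.
Qed.

(** The image is even open: the inverse chart is continuous on an open set, so the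
condition on [f] holds near the image of [x]. *)
Lemma chart_image_near n (M : manifold R n) (T : topologicalType) (f : M -> T)
    (i : chart M) (x : M) (B : set T) :
  continuous f -> open B -> chart_dom i x -> B (f x) ->
  \forall y \near chart_map i x,
    (chart_map i @` (chart_dom i `&` f @^-1` B)) y.
Proof.
move=> cf oB ix Bfx; set q := chart_map i x; set D := chart_map i @` chart_dom i.
have Dq : D q by exists x.
have oD : open D by exact: chart_image_open.
have cinv : {in D, continuous (chart_inv i)}.
  by rewrite -continuous_open_subspace//; exact: chart_inv_continuous.
have iq : chart_inv i q = x by exact: chart_mapK.
have nB : \forall y \near q, B (f (chart_inv i y)).
  have cq : {for q, continuous (chart_inv i)} by apply: cinv; rewrite inE.
  have nfB : nbhs x (f @^-1` B).
    by apply: (cf x); apply: open_nbhs_nbhs; split.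
  rewrite -iq in nfB; exact: cq nfB.
apply: filterS2 nB (open_nbhs_nbhs (conj oD Dq)) => y By [x' ix' xy].
exists x' => //; split=> //; move: By; by rewrite -xy chart_mapK.
Qed.

Lemma regular_map_chart n m (M : manifold R n) (N : manifold R m) (f : M -> N)
    (i : chart M) (j : chart N) y :
  immersion f -> (chart_map i @` (chart_dom i `&` f @^-1` chart_dom j)) y ->
  regular_map_at (map_in_charts f i j) y.
Proof.
move=> [_ /(_ i j 3)[dF ddF] _] Dy; split; first exact: dF.
  by move=> u; have [+ _] := ddF u; exact.
by move=> u v; have [_ /(_ u)[+ _]] := ddF v; exact.
Qed.

End Charts.

(* X and the frames e, b are given by their components in the chart i. *)
Theorem corollary4p5 (R : realType) (n p : nat) (n_ge2 : (2 <= n)%N) (c : R)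
    (N : manifold R (n + p)) (g : metric N) (g_const : constant_curvature g c)
    (phi : one_form N) (M : manifold R n) (f : M -> N) (f_imm : immersion f)
    (x : M) (i : chart M) (j : chart N) (xi : chart_dom i x) (fxj : chart_dom j (f x))
    (X : 'rV[R]_n) (e b : 'I_n -> 'rV[R]_n) :
  let F := map_in_charts f i j in
  let q := chart_map i x in
  let gM := induced_metric (g j) F q in
  let gN := g j (F q) in
  let H := mean_curvature (g j) (phi j) F q e in
  let normH := vnorm gN H in
  let normsigma := norm_sff (g j) (phi j) F q e in
  let PhiX := Phi_ricci (g j) (phi j) F c q e X in
  let Ric := ricci (g j) (phi j) F q X b in
  vnorm gM X = 1 ->
  orthonormal_basis gM e ->
  orthonormal_basis gM b ->
  b (Ordinal (ltnW n_ge2)) = X ->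
  [/\ PhiX + calH n normH normsigma <= Ric,
      Ric <= PhiX + n%:R ^+ 2 / 4 * normH ^+ 2
    & (PhiX + n%:R ^+ 2 / 4 * normH ^+ 2) - (PhiX + calH n normH normsigma)
      = n%:R ^+ 2 / 4 * normH ^+ 2 - calH n normH normsigma].
Proof.
move=> F q gM gN H normH normsigma PhiX Ric _ orth_e orth_b bX.
have FE x' : chart_dom i x' -> F (chart_map i x') = chart_map j (f x').
  by move=> ix'; rewrite /F /map_in_charts /= chart_mapK.
have [cf sf rf] := f_imm.
have nearD := chart_image_near cf (chart_dom_open j) xi fxj.
have regF : \forall y \near q, regular_map_at F y.
  by apply: filterS nearD => y; exact: regular_map_chart.
have regG : \forall z \near F q, regular_metric_at (g j) z.
  have Dz : (chart_map j @` chart_dom j) (F q) by rewrite FE//; exists (f x).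
  have nz : nbhs (F q) (chart_map j @` chart_dom j).
    by apply: open_nbhs_nbhs; split=> //; exact: chart_image_open.
  apply: filterS nz => z [w jw <-].
  exact: regular_metric_chart.
have dphi : differentiable (phi j) (F q).
  by have [+ _] := form_smooth phi j 1; apply; rewrite FE//; exists (f x).
have unitI : \forall y \near q, induced_metric (g j) F y \in unitmx.
  apply: filterS nearD => y [x' [ix' jx'] <-]; apply: induced_metric_unitmx.
    by move=> u u0; rewrite FE//; exact: metric_posdef.
  exact: rf.
have posG u : u != 0 -> 0 < bil (g j (F q)) u u.
  by move=> u0; rewrite FE//; exact: metric_posdef.
have curvG Y Z V W : bil (g j (F q)) (curvature_at (levi_civita (g j)) (F q) Y Z V) W =
    c * (bil (g j (F q)) Y W * bil (g j (F q)) Z V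
         - bil (g j (F q)) Y V * bil (g j (F q)) Z W).
  by rewrite FE//; exact: g_const.
have := ricci_bounds regF regG dphi unitI posG curvG n_ge2 orth_e orth_b.
rewrite bX => /andP[lower upper]; split=> //.
by rewrite opprD addrACA subrr add0r.
Qed.
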